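(* Let $S$ be a poset in the class $\mathcal{C}$ and let $K$ be a field. Then: (a) $\phi^0_S=0$ and the incidence algebra $KS$ is of cyclotomic type. (b) If $\Lambda$ is a triangular algebra and $v$ is a vertex in its quiver, then $\phi_{\Lambda\xleftarrow{v}S}=\phi_{\Lambda^-}\cdot\phi_S$. In particular, if $\Lambda^-$ is of cyclotomic type, then so is $\Lambda\xleftarrow{v}S$.
   Context: All posets are finite. Let $K$ be a field. For a finite quiver $Q$ with vertex set $Q_0$ and arrow set $Q_1$, write $h(\alpha)$ and $t(\alpha)$ for the vertices at which an arrow (or path) $\alpha$ starts and ends, respectively; paths are composed from left to right, and two paths $p,q$ are parallel if $h(p)=h(q)$ and $t(p)=t(q)$. A triangular algebra is a quotient $\Lambda = KQ/I$ where $Q$ is a finite quiver without oriented cycles and $I$ is an ideal generated by linear combinations of parallel paths of lengths at least $2$. Its Cartan matrix $C_\Lambda$ is indexed by $Q_0$, with $(C_\Lambda)_{ij} = \dim_K \mathrm{Hom}_\Lambda(P_i,P_j)$, $P_i = e_i\Lambda$; this is the dimension of the image in $KQ/I$ of the span of paths from $j$ to $i$. Its Coxeter polynomial is $\phi_\Lambda(x) = \det(xC_\Lambda + C_\Lambda^T)$ (equal to $1$ for the zero algebra). $\Lambda$ is of cyclotomic type if $\phi_\Lambda$ is a product of cyclotomic polynomials. For $v\in Q_0$, $e_v$ is the corresponding primitive idempotent and $\Lambda^- = (1-e_v)\Lambda(1-e_v)$. The Hasse quiver $Q_S$ of a poset $S$ has the elements of $S$ as vertices and an arrow $s\to s'$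 whenever $s'$ covers $s$. $S_{\min}$ and $S_{\max}$ are the sets of minimal and maximal elements of $S$. The incidence algebra $KS$ is $KQ_S$ modulo all differences of parallel paths; its Cartan matrix $C_S$ has $(C_S)_{st}=1$ if $t\le s$ and $0$ otherwise, and $\phi_S=\phi_{KS}=\det(xC_S+C_S^T)$. Insertion into an algebra: let $\Lambda = KQ/I$ be a triangular algebra, $v\in Q_0$, $S$ a nonempty poset. The insertion $\Lambda \xleftarrow{v} S$ is $K\widetilde{Q}/\widetilde{I}$, where $\widetilde{Q}_0 = (Q_0\setminus\{v\})\cup S$, and $\widetilde{Q}_1$ consists of: the arrows $\gamma\in Q_1$ with $h(\gamma),t(\gamma)\ne v$; the arrows of $Q_S$; an arrow $(\alpha,s)$ from $h(\alpha)$ to $s$ for each $\alpha\in Q_1$ with $t(\alpha)=v$ and $s\in S_{\min}$; an arrow $(s,\beta)$ from $s$ to $t(\beta)$ for each $\beta\in Q_1$ with $h(\beta)=v$ and $s\in S_{\max}$. For a path $p$ in $Q$ ending at $v$ and $s\in S_{\min}$, let $(p,s)$ be obtained from $p$ by replacing its last arrow $\alpha$ by $(\alpha,s)$; define $(s,p)$ similarly for $p$ starting at $v$ and $s\in S_{\max}$. The ideal $\widetilde{I}$ is generated by: (1a) $\sum c_p (p,s)$ for $s\in S_{\min}$ and $\sum c_p p\in I$ a linear combination of parallel paths ending at $v$; (1b) $\sum c_p (s,p)$ for $s\in S_{\max}$ and $\sum c_p p\in I$ a linear combination of parallel paths starting at $v$; (2a) $q'-q''$ for parallel paths $q',q''$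 in $Q_S$; (2b) $(\alpha,h(q'))q' - (\alpha,h(q''))q''$ for $\alpha\in Q_1$ ending at $v$ and paths $q',q''$ in $Q_S$ with $h(q'),h(q'')\in S_{\min}$, $t(q')=t(q'')$; (2c) $q'(t(q'),\beta)-q''(t(q''),\beta)$ for $\beta\in Q_1$ starting at $v$ and paths $q',q''$ in $Q_S$ with $t(q'),t(q'')\in S_{\max}$, $h(q')=h(q'')$; (2d) $(\alpha,h(q'))q'(t(q'),\beta)-(\alpha,h(q''))q''(t(q''),\beta)$ for $\alpha,\beta\in Q_1$ with $t(\alpha)=h(\beta)=v$ and paths $q',q''$ in $Q_S$ with $h(q'),h(q'')\in S_{\min}$, $t(q'),t(q'')\in S_{\max}$; (3) $\sum c_p\widetilde{p}$ for $\sum c_p p\in I$ a linear combination of parallel paths neither starting nor ending at $v$, where $\widetilde{p}=p$ if $p$ does not pass through $v$, and otherwise, writing $p=p'p''$ with $t(p')=h(p'')=v$, $\widetilde{p} = (p',h(q))\,q\,(t(q),p'')$ for some path $q$ in $Q_S$ with $h(q)\in S_{\min}$, $t(q)\in S_{\max}$ (the choice of $q$ is irrelevant modulo the other relations). The algebra $\Lambda\xleftarrow{v}S$ is again triangular. By convention $\Lambda \xleftarrow{v}\varnothing = \Lambda^-$. Insertion into a poset: for a poset $(X,\le_X)$, $v\in X$, and a poset $(S,\le_S)$, $X\xleftarrow{v}S$ is the disjoint union $(X\setminus\{v\})\cup S$ with the order: for $x,x'\in X\setminus\{v\}$, $s,s'\in S$: $x\le x'\iff x\le_X x'$; $s\le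 s'\iff s\le_S s'$; $x\le s\iff x\le_X v$; $s\le x\iff v\le_X x$. Refined Coxeter polynomial $\phi^0_S\in\mathbb{Z}[x]$: if $S=\varnothing$, $\phi^0_S=0$. If $S\ne\varnothing$, choose $s\in S$, and let $A$ be the matrix obtained from $xC_S+C_S^T$ by subtracting the $s$-th row from all other rows and then the $s$-th column from all other columns; $\phi^0_S$ is the principal minor of $A$ on $S\setminus\{s\}$ (independent of $s$). A poset is of type $\widetilde{A}$ if its incidence algebra is a path algebra of an orientation of a Euclidean diagram of type $\widetilde{A}$; explicitly, its Hasse quiver is an orientation of a cycle whose clockwise arrows form $k$ maximal runs and whose anti-clockwise arrows form $k$ maximal runs, with $k\ge2$. The class $\mathcal{C}$ of posets (up to isomorphism) is defined recursively as the smallest class such that: the empty poset belongs to $\mathcal{C}$; and if $X$ is a poset with an element $v\in X$ such that $X\setminus\{v\}\in\mathcal{C}$, then $X\xleftarrow{v}S\in\mathcal{C}$ for any poset $S$ of type $\widetilde{A}$. *)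

(* Defs.v *)
From HB Require Import structures.
From mathcomp Require Import all_boot all_order all_algebra.
From mathcomp Require Import cyclotomic boolp.

Set Implicit Arguments.
Unset Strict Implicit.
Unset Printing Implicit Defensive.

Import Order.TTheory GRing.Theory Num.Theory.
Local Open Scope ring_scope.

(* The smallest subspace containing a (possibly infinite) set of vectors. *)
Section SpanOfSet.
Variables (K : fieldType) (V : vectType K).

Lemma vspan_exists (P : V -> Prop) : exists U : {vspace V},
  (forall x, P x -> x \in U) /\
  (forall W : {vspace V}, (forall x, P x -> x \in W) -> (U <= W)%VS).
Proof.
pose dimP n := `[< exists2 U : {vspace V}, (forall x, P x -> x \in U) & \dim U = n >].
have dimPx : exists n, dimP n.
  by exists (\dim {:V}%VS); apply/asboolP; exists fullv => // x _; rewrite memvf.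
case: (ex_minnP dimPx) => n /asboolP[U PU dimU] min_n.
exists U; split=> // W PW.
have /min_n leUW : dimP (\dim (U :&: W)%VS).
  by apply/asboolP; exists (U :&: W)%VS => // x Px; rewrite memv_cap PU ?PW.
have /eqP <- : (U :&: W == U)%VS by rewrite eqEdim capvSl dimU.
exact: capvSr.
Qed.

Definition vspan (P : V -> Prop) : {vspace V} := sval (cid (vspan_exists P)).

Lemma mem_vspan P x : P x -> x \in vspan P.
Proof. by rewrite /vspan; case: cid => U [/= PU _]; exact: PU. Qed.

Lemma vspan_min P (W : {vspace V}) :
  (forall x, P x -> x \in W) -> (vspan P <= W)%VS.
Proof. by rewrite /vspan; case: cid => U [/= _ minU]; exact: minU. Qed.

End SpanOfSet.

(* Finite-dimensional associative unital K-algebras. Unlike falgType, this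
   structure allows the zero algebra. *)
HB.mixin Record Vector_isFDAlg (K : fieldType) A of Vector K A := {
  fdone : A;
  fdmul : A -> A -> A;
  fdmulA : associative fdmul;
  fdmul1x : left_id fdone fdmul;
  fdmulx1 : right_id fdone fdmul;
  fdmulDl : left_distributive fdmul +%R;
  fdmulDr : right_distributive fdmul +%R;
  fdscaleAl : forall (c : K) (x y : A), c *: fdmul x y = fdmul (c *: x) y;
  fdscaleAr : forall (c : K) (x y : A), c *: fdmul x y = fdmul x (c *: y)
}.

#[short(type="fdalgType")]
HB.structure Definition FDAlg (K : fieldType) :=
  {A of Vector K A & Vector_isFDAlg K A}.

Notation "x ** y" := (fdmul x y) (at level 40, left associativity) : ring_scope.
Notation "\fd1" := fdone (at level 0) : ring_scope.

Section FDAlgebras.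
Variables (K : fieldType) (A : fdalgType K).
Implicit Types a b c x y : A.

Definition lmulA a x : A := a ** x.
Definition rmulA a x : A := x ** a.

Fact lmulA_is_linear a : linear (lmulA a).
Proof. by move=> c x y; rewrite /lmulA fdmulDr fdscaleAr. Qed.
HB.instance Definition _ a :=
  GRing.isLinear.Build K A A *:%R (lmulA a) (lmulA_is_linear a).

Fact rmulA_is_linear a : linear (rmulA a).
Proof. by move=> c x y; rewrite /rmulA fdmulDl fdscaleAl. Qed.
HB.instance Definition _ a :=
  GRing.isLinear.Build K A A *:%R (rmulA a) (rmulA_is_linear a).

Lemma fdmulBl x y a : (x - y) ** a = x ** a - y ** a.
Proof. exact: (linearB (rmulA a)). Qed.
Lemma fdmulBr a x y : a ** (x - y) = a ** x - a ** y.
Proof. exact: (linearB (lmulA a)). Qed.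

HB.instance Definition _ :=
  Monoid.isLaw.Build A fdone fdmul (@fdmulA K A) (@fdmul1x K A) (@fdmulx1 K A).

Definition right_ideal (e : A) : {vspace A} := limg (linfun (lmulA e)).

Definition is_module_hom (U V : {vspace A}) (f : 'Hom(subvs_of U, subvs_of V)) :=
  forall (x y : subvs_of U) (a : A),
    vsval y = vsval x ** a -> vsval (f y) = vsval (f x) ** a.

Definition module_hom (U V : {vspace A}) : {vspace 'Hom(subvs_of U, subvs_of V)} :=
  vspan (@is_module_hom U V).

Lemma module_homP (U V : {vspace A}) (f : 'Hom(subvs_of U, subvs_of V)) :
  (forall x a, x \in U -> x ** a \in U) ->
  f \in module_hom U V <-> is_module_hom f.
Proof.
move=> UA; split=> [fh x y a yE|]; last exact: mem_vspan.
pose g := fun h : 'Hom(subvs_of U, subvs_of V) => vsval (h y) - vsval (h x) ** a.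
have g_lin : linear g.
  move=> c h k; rewrite /g !add_lfunE !scale_lfunE.
  rewrite !(linearP (vsval : subvs_of V -> A)) /= fdmulDl -fdscaleAl.
  by rewrite scalerBr opprD addrACA.
pose gL := GRing.isLinear.Build K _ _ *:%R g g_lin.
pose G : {linear _ -> _} := HB.pack g gL.
suff /subvP/(_ _ fh) : (module_hom U V <= lker (linfun G))%VS.
  by rewrite memv_ker lfunE /= subr_eq0 => /eqP.
apply: vspan_min => h hh; rewrite memv_ker lfunE /= /g.
by rewrite (hh _ _ _ yE) subrr.
Qed.

Definition two_sided (I : {vspace A}) :=
  (forall a x, x \in I -> a ** x \in I) /\ (forall a x, x \in I -> x ** a \in I).

Definition ideal_gen (G : A -> Prop) : {vspace A} :=
  vspan (fun x => exists a g b, G g /\ x = a ** g ** b).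

Lemma ideal_gen_two_sided G : two_sided (ideal_gen G).
Proof.
split=> a x Ix.
  suff /subvP/(_ _ Ix) : (ideal_gen G <= linfun (lmulA a) @^-1: ideal_gen G)%VS.
    by rewrite -memv_preim lfunE.
  apply: vspan_min => _ [b [g [c [Gg ->]]]]; rewrite -memv_preim lfunE /= /lmulA.
  by apply: mem_vspan; exists (a ** b), g, c; rewrite !fdmulA.
suff /subvP/(_ _ Ix) : (ideal_gen G <= linfun (rmulA a) @^-1: ideal_gen G)%VS.
  by rewrite -memv_preim lfunE.
apply: vspan_min => _ [b [g [c [Gg ->]]]]; rewrite -memv_preim lfunE /= /rmulA.
by apply: mem_vspan; exists b, g, (c ** a); rewrite !fdmulA.
Qed.

Lemma mem_ideal_gen (G : A -> Prop) g : G g -> g \in ideal_gen G.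
Proof. by move=> Gg; apply: mem_vspan; exists fdone, g, fdone; rewrite fdmul1x fdmulx1. Qed.

End FDAlgebras.

(* The quotient A / I, carried by the complement I^C of I in A. *)
Section QuotientAlgebra.
Variables (K : fieldType) (A : fdalgType K) (I : {vspace A}).

Definition quotalg (HI : two_sided I) : Type := subvs_of I^C%VS.

Variable HI : two_sided I.
Local Notation Q := (quotalg HI).
HB.instance Definition _ := Vector.on Q.

Definition quotpi (x : A) : Q := vsproj I^C%VS (daddv_pi I^C%VS I x).
Definition quotrepr (x : Q) : A := vsval (x : subvs_of I^C%VS).

Let capCv : (I^C :&: I = 0)%VS. Proof. by rewrite capvC capv_compl. Qed.

Fact quotpi_is_linear : linear quotpi.
Proof. by move=> c x y; rewrite /quotpi !linearP. Qed.
HB.instance Definition _ :=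
  GRing.isLinear.Build K A Q *:%R quotpi quotpi_is_linear.

Lemma quotreprK : cancel quotrepr quotpi.
Proof.
by move=> x; rewrite /quotpi daddv_pi_id ?vsvalK //; exact: subvsP.
Qed.

Lemma quotpi_eq0 x : (quotpi x == 0) = (x \in I).
Proof.
have xE : daddv_pi I^C%VS I x + daddv_pi I I^C%VS x = x.
  by apply: daddv_pi_add => //; rewrite addvC addv_complf memvf.
apply/eqP/idP => [/(congr1 quotrepr)|Ix].
  rewrite /quotrepr /quotpi vsprojK ?memv_pi // linear0 => x0.
  by rewrite -xE x0 add0r memv_pi.
have xE' := daddv_pi_id (capv_compl I) Ix.
suff -> : quotpi x = vsproj I^C%VS 0 by rewrite linear0.
by rewrite /quotpi; congr (vsproj _ _); apply: (addIr x); rewrite add0r -{2}xE' xE.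
Qed.

Lemma quotpi_eq x y : (quotpi x == quotpi y) = (x - y \in I).
Proof. by rewrite -subr_eq0 -linearB quotpi_eq0. Qed.

Lemma quotreprB x : quotrepr (quotpi x) - x \in I.
Proof. by rewrite -quotpi_eq quotreprK. Qed.

Definition quotmul (x y : Q) : Q := quotpi (quotrepr x ** quotrepr y).

Lemma quotpi_mul x y : quotpi (x ** y) = quotmul (quotpi x) (quotpi y).
Proof.
apply/esym/eqP; rewrite /quotmul quotpi_eq.
set x' := quotrepr _; set y' := quotrepr _.
have -> : x' ** y' - x ** y = (x' - x) ** y' + x ** (y' - y).
  by rewrite fdmulBl fdmulBr addrA subrK.
by apply: memvD; [apply: HI.2 | apply: HI.1]; exact: quotreprB.
Qed.

Fact quotmulA : associative quotmul.
Proof.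
move=> x y z; rewrite -[x]quotreprK -[y]quotreprK -[z]quotreprK.
by rewrite -!quotpi_mul fdmulA.
Qed.
Fact quotmul1x : left_id (quotpi fdone) quotmul.
Proof. by move=> x; rewrite -[x]quotreprK -quotpi_mul fdmul1x. Qed.
Fact quotmulx1 : right_id (quotpi fdone) quotmul.
Proof. by move=> x; rewrite -[x]quotreprK -quotpi_mul fdmulx1. Qed.
Fact quotmulDl : left_distributive quotmul +%R.
Proof.
move=> x y z; rewrite -[x]quotreprK -[y]quotreprK -[z]quotreprK.
by rewrite -linearD -!quotpi_mul fdmulDl linearD.
Qed.
Fact quotmulDr : right_distributive quotmul +%R.
Proof.
move=> x y z; rewrite -[x]quotreprK -[y]quotreprK -[z]quotreprK.
by rewrite -linearD -!quotpi_mul fdmulDr linearD.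
Qed.
Fact quotscaleAl (c : K) (x y : Q) : c *: quotmul x y = quotmul (c *: x) y.
Proof.
rewrite -[x]quotreprK -[y]quotreprK -quotpi_mul -[LHS]linearZ.
by rewrite -[X in quotmul X _]linearZ -quotpi_mul fdscaleAl.
Qed.
Fact quotscaleAr (c : K) (x y : Q) : c *: quotmul x y = quotmul x (c *: y).
Proof.
rewrite -[x]quotreprK -[y]quotreprK -quotpi_mul -[LHS]linearZ.
by rewrite -[X in quotmul _ X]linearZ -quotpi_mul fdscaleAr.
Qed.
HB.instance Definition _ := Vector_isFDAlg.Build K Q
  quotmulA quotmul1x quotmulx1 quotmulDl quotmulDr quotscaleAl quotscaleAr.

End QuotientAlgebra.

(* The algebra f A f, with unit f, for an idempotent f. *)
Section CornerAlgebra.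
Variables (K : fieldType) (A : fdalgType K) (f : A).

Definition corner_space : {vspace A} :=
  limg (linfun (rmulA f) \o linfun (lmulA f))%VF.

Definition corner_alg (Hf : f ** f = f) : Type := subvs_of corner_space.

Variable Hf : f ** f = f.
Local Notation C := (corner_alg Hf).
HB.instance Definition _ := Vector.on C.

Definition cval (x : C) : A := vsval (x : subvs_of corner_space).
Definition cproj (x : A) : C := vsproj corner_space x.

Lemma corner_spaceP x : reflect (f ** x ** f = x) (x \in corner_space).
Proof.
apply: (iffP idP) => [/memv_imgP[y _ ->]|fxf].
  by rewrite comp_lfunE !lfunE /= /rmulA /lmulA !fdmulA Hf -!fdmulA Hf.
apply/memv_imgP; exists x; rewrite ?memvf //.
by rewrite comp_lfunE !lfunE /= /rmulA /lmulA fxf.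
Qed.

Lemma cvalP x : f ** cval x ** f = cval x.
Proof. by apply/corner_spaceP; exact: subvsP. Qed.
Lemma cvalK : cancel cval cproj. Proof. exact: vsvalK. Qed.
Lemma cprojK x : f ** x ** f = x -> cval (cproj x) = x.
Proof. by move=> /corner_spaceP; exact: vsprojK. Qed.
Lemma cval_inj : injective cval. Proof. exact: can_inj cvalK. Qed.
Fact cval_is_linear : linear cval.
Proof. by move=> c x y; exact: (linearP (vsval : subvs_of corner_space -> A)). Qed.
HB.instance Definition _ :=
  GRing.isLinear.Build K C A *:%R cval cval_is_linear.

Lemma mulf_cval x : f ** cval x = cval x.
Proof. by rewrite -(cvalP x) !fdmulA Hf. Qed.
Lemma cval_mulf x : cval x ** f = cval x.
Proof. by rewrite -(cvalP x) -!fdmulA Hf. Qed.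

Definition corner_mul (x y : C) : C := cproj (cval x ** cval y).

Lemma cvalM x y : cval (corner_mul x y) = cval x ** cval y.
Proof. by rewrite cprojK // fdmulA mulf_cval -fdmulA cval_mulf. Qed.
Lemma cval1 : cval (cproj f) = f.
Proof. by rewrite cprojK // !Hf. Qed.

Fact corner_mulA : associative corner_mul.
Proof. by move=> x y z; apply: cval_inj; rewrite !cvalM fdmulA. Qed.
Fact corner_mul1x : left_id (cproj f) corner_mul.
Proof. by move=> x; apply: cval_inj; rewrite cvalM cval1 mulf_cval. Qed.
Fact corner_mulx1 : right_id (cproj f) corner_mul.
Proof. by move=> x; apply: cval_inj; rewrite cvalM cval1 cval_mulf. Qed.
Lemma cvalD x y : cval (x + y) = cval x + cval y. Proof. exact: linearD. Qed.
Lemma cvalZ c x : cval (c *: x) = c *: cval x. Proof. exact: linearZ. Qed.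
Fact corner_mulDl : left_distributive corner_mul +%R.
Proof. by move=> x y z; apply: cval_inj; rewrite cvalD !cvalM cvalD fdmulDl. Qed.
Fact corner_mulDr : right_distributive corner_mul +%R.
Proof. by move=> x y z; apply: cval_inj; rewrite cvalD !cvalM cvalD fdmulDr. Qed.
Fact corner_scaleAl (c : K) (x y : C) :
  c *: corner_mul x y = corner_mul (c *: x) y.
Proof. by apply: cval_inj; rewrite cvalZ !cvalM cvalZ fdscaleAl. Qed.
Fact corner_scaleAr (c : K) (x y : C) :
  c *: corner_mul x y = corner_mul x (c *: y).
Proof. by apply: cval_inj; rewrite cvalZ !cvalM cvalZ fdscaleAr. Qed.
HB.instance Definition _ := Vector_isFDAlg.Build K C
  corner_mulA corner_mul1x corner_mulx1 corner_mulDl corner_mulDr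
  corner_scaleAl corner_scaleAr.

End CornerAlgebra.

(* A finite-dimensional algebra with a complete family of orthogonal
   idempotents. *)
Record palg (K : fieldType) := PAlg {
  palg_alg :> fdalgType K;
  palg_idx : finType;
  palg_e : palg_idx -> palg_alg;
  palg_eM : forall i j, palg_e i ** palg_e j = if i == j then palg_e i else 0;
  palg_e1 : \sum_i palg_e i = fdone
}.
Arguments palg_e {K p} i.
Arguments PAlg {K} palg_alg palg_idx palg_e.

Definition fin_det (R : comPzRingType) (T : finType) (M : T -> T -> R) : R :=
  \det (\matrix_(i < #|T|, j < #|T|) M (enum_val i) (enum_val j)).

Definition cyclotomic_product (p : {poly int}) : Prop :=
  exists2 s : seq nat, all (ltn 0) s & p = \prod_(n <- s) 'Phi_n.

Section Coxeter.
Variables (K : fieldType) (L : palg K).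

(* \dim_K Hom_L(P_i, P_j) for the right modules P_i = e_i L *)
Definition cartan (i j : palg_idx L) : nat :=
  \dim (module_hom (right_ideal (palg_e i)) (right_ideal (palg_e j))).

Definition coxeter_poly : {poly int} :=
  fin_det (fun i j => 'X * (cartan i j)%:R + (cartan j i)%:R).

Definition cyclotomic_type : Prop := cyclotomic_product coxeter_poly.

End Coxeter.

Section Corner.
Variables (K : fieldType) (L : palg K) (v : palg_idx L).

Lemma corner_unitP :
  (fdone - palg_e v) ** (fdone - palg_e v) = fdone - palg_e v.
Proof.
by rewrite fdmulBl fdmul1x !fdmulBr fdmulx1 palg_eM eqxx subrr subr0.
Qed.

Local Notation C := (corner_alg corner_unitP).

Definition corner_e (i : {i : palg_idx L | i != v}) : C :=
  cproj corner_unitP (palg_e (val i)).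

Lemma cval_corner_e i : cval (corner_e i) = palg_e (val i).
Proof.
have iv := negPf (valP i).
rewrite cprojK // fdmulBl fdmul1x palg_eM eq_sym iv subr0.
by rewrite fdmulBr fdmulx1 palg_eM iv subr0.
Qed.

Fact corner_eM i j : corner_e i ** corner_e j = if i == j then corner_e i else 0.
Proof.
apply: cval_inj; rewrite cvalM !cval_corner_e palg_eM (inj_eq val_inj).
by case: eqP => _; rewrite ?cval_corner_e ?linear0.
Qed.

Fact corner_e1 : \sum_i corner_e i = fdone.
Proof.
have e1 : fdone - palg_e v = \sum_(i | i != v) palg_e i.
  by rewrite -(palg_e1 L) (bigD1 v) //= addrAC subrr add0r.
apply: cval_inj; rewrite linear_sum /= cval1; apply: etrans (esym e1).
rewrite [RHS](reindex_omap (val : {i | i != v} -> _) insub) /=; last first.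
  by move=> i iv; rewrite insubT.
apply: eq_big => [i|i _]; last by rewrite cval_corner_e.
by rewrite valK eqxx (valP i).
Qed.

Definition corner : palg K := PAlg C _ corner_e corner_eM corner_e1.

End Corner.

Section QuotientPalg.
Variables (K : fieldType) (L : palg K) (I : {vspace L}) (HI : two_sided I).

Definition quot_e (i : palg_idx L) : quotalg HI := quotpi HI (palg_e i).

Fact quot_eM i j : quot_e i ** quot_e j = if i == j then quot_e i else 0.
Proof.
rewrite -[LHS](quotpi_mul HI) palg_eM /quot_e.
by case: eqP => _ //; rewrite linear0.
Qed.

Fact quot_e1 : \sum_i quot_e i = fdone.
Proof. by rewrite -linear_sum palg_e1. Qed.

Definition quot_palg : palg K := PAlg (quotalg HI) _ quot_e quot_eM quot_e1.

End QuotientPalg.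

Section Walks.
Variables (V A : eqType) (s t : A -> V).

Fixpoint walk (i : V) (p : seq A) : bool :=
  if p is a :: p' then (s a == i) && walk (t a) p' else true.

Definition walk_end (i : V) (p : seq A) : V := last i (map t p).

Lemma walk_cat i p q : walk i (p ++ q) = walk i p && walk (walk_end i p) q.
Proof. by elim: p i => //= a p IH i; rewrite IH andbA. Qed.

Lemma walk_end_cat i p q : walk_end i (p ++ q) = walk_end (walk_end i p) q.
Proof. by rewrite /walk_end map_cat last_cat. Qed.

End Walks.

(* Finite quivers without oriented cycles; an arrow a goes from src a to
   tgt a. *)
Record quiver := Quiver {
  vert : finType;
  arr : finType;
  src : arr -> vert;
  tgt : arr -> vert;
  acyclic : forall i p, walk src tgt i p -> walk_end tgt i p = i -> p = [::]
}.

Arguments Quiver {vert arr} src tgt acyclic.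

(* Paths, including the trivial ones: a starting vertex and a sequence of
   composable arrows, from left to right. *)
Section Paths.
Variable Q : quiver.

Record qpath := QPath {
  qpath_val : vert Q * seq (arr Q);
  _ : walk (@src Q) (@tgt Q) qpath_val.1 qpath_val.2
}.

HB.instance Definition _ := [isSub for qpath_val].
HB.instance Definition _ := [Countable of qpath by <:].

Definition qsrc (p : qpath) : vert Q := (qpath_val p).1.
Definition qarr (p : qpath) : seq (arr Q) := (qpath_val p).2.
Definition qtgt (p : qpath) : vert Q := walk_end (@tgt Q) (qsrc p) (qarr p).

Lemma qpathP (p : qpath) : walk (@src Q) (@tgt Q) (qsrc p) (qarr p).
Proof. exact: (valP p). Qed.

Lemma walk_uniq i p :
  walk (@src Q) (@tgt Q) i p -> uniq (i :: map (@tgt Q) p).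
Proof.
elim: p i => //= a p IH i /andP[/eqP ai wp].
have /= /andP[-> ->] := IH _ wp; rewrite !andbT.
apply/negP => i_in.
have [p1 [p2 [p12 ei]]] : exists p1 p2, a :: p = p1 ++ p2 /\
    p1 != [::] /\ walk_end (@tgt Q) i p1 = i.
  have /= lt_ip : (index i (map (@tgt Q) (a :: p)) < size (a :: p))%N.
    by rewrite -(size_map (@tgt Q)) index_mem.
  exists (take (index i (map (@tgt Q) (a :: p))).+1 (a :: p)).
  exists (drop (index i (map (@tgt Q) (a :: p))).+1 (a :: p)).
  rewrite cat_take_drop; split=> //; split=> //.
  rewrite /walk_end map_take (take_nth i) ?size_map // last_rcons.
  by rewrite nth_index.
have wap : walk (@src Q) (@tgt Q) i (a :: p) by rewrite /= ai eqxx.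
move: wap; rewrite p12 walk_cat => /andP[w1 _].
by case: ei => /eqP n1 e1; apply: n1; apply: acyclic w1 e1.
Qed.

Lemma size_qarr (p : qpath) : (size (qarr p) <= #|vert Q|)%N.
Proof.
have /card_uniqP := walk_uniq (qpathP p).
rewrite /= size_map => sz; apply: leq_trans (leqnSn _) _.
by rewrite -sz max_card.
Qed.

Definition qpath_code (p : qpath) : vert Q * {bseq #|vert Q| of arr Q} :=
  (qsrc p, insub_bseq _ (qarr p)).
Definition qpath_decode (x : vert Q * {bseq #|vert Q| of arr Q}) : option qpath :=
  insub (x.1, (x.2 : seq (arr Q))).

Fact qpath_codeK : pcancel qpath_code qpath_decode.
Proof.
move=> p; rewrite /qpath_decode /=.
have -> : insub_bseq #|vert Q| (qarr p) = qarr p :> seq _.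
  by rewrite /insub_bseq insubdK // -topredE /= size_qarr.
by rewrite -surjective_pairing valK.
Qed.
HB.instance Definition _ : isFinite qpath := PCanIsFinite qpath_codeK.

Definition qconcat (p q : qpath) : option qpath :=
  if qtgt p == qsrc q then insub (qsrc p, qarr p ++ qarr q) else None.

Definition qtriv (i : vert Q) : qpath := QPath (isT : walk _ _ (i, [::]).1 [::]).

Fact qsingle_proof (a : arr Q) : walk (@src Q) (@tgt Q) (src a, [:: a]).1 [:: a].
Proof. by rewrite /= eqxx. Qed.
Definition qsingle (a : arr Q) : qpath := QPath (qsingle_proof a).

Lemma qconcatE p q r : (qconcat p q == Some r) =
  [&& qtgt p == qsrc q, qsrc r == qsrc p & qarr r == qarr p ++ qarr q].
Proof.
rewrite /qconcat; case: (qtgt p =P qsrc q) => // pq.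
have w : walk (@src Q) (@tgt Q) (qsrc p, qarr p ++ qarr q).1 (qarr p ++ qarr q).
  by rewrite walk_cat qpathP /= -/(qtgt p) pq qpathP.
rewrite (insubT (fun x => walk _ _ x.1 x.2) w) (inj_eq Some_inj) -val_eqE eq_sym.
by rewrite [val r]surjective_pairing xpair_eqE.
Qed.

Lemma qtgt_concat p q r : qconcat p q = Some r ->
  [/\ qtgt p = qsrc q, qsrc r = qsrc p, qarr r = qarr p ++ qarr q & qtgt r = qtgt q].
Proof.
move/eqP; rewrite qconcatE => /and3P[/eqP pq /eqP sr /eqP ar]; split=> //.
by rewrite {1}/qtgt sr ar walk_end_cat -/(qtgt p) pq.
Qed.

Lemma qconcat_some p q : qtgt p = qsrc q -> exists r, qconcat p q = Some r.
Proof.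
move=> pq; rewrite /qconcat pq eqxx.
have w : walk (@src Q) (@tgt Q) (qsrc p, qarr p ++ qarr q).1 (qarr p ++ qarr q).
  by rewrite walk_cat qpathP /= -/(qtgt p) pq qpathP.
by exists (QPath w); rewrite (insubT (fun x => walk _ _ x.1 x.2) w).
Qed.

Lemma qconcat_none p q : qtgt p <> qsrc q -> qconcat p q = None.
Proof. by rewrite /qconcat; case: (qtgt p =P qsrc q). Qed.

Lemma qpath_inj p q : qsrc p = qsrc q -> qarr p = qarr q -> p = q.
Proof.
move=> spq apq; apply: val_inj.
by rewrite /= [LHS]surjective_pairing [RHS]surjective_pairing; congr (_, _).
Qed.

Lemma qconcatA p q r :
  obind (qconcat p) (qconcat q r) = obind (qconcat^~ r) (qconcat p q).
Proof.
have [pq|npq] := eqVneq (qtgt p) (qsrc q); last first.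
  rewrite (qconcat_none (elimN eqP npq)) /=.
  case qr: (qconcat q r) => [u|] //=; apply: qconcat_none.
  by case: (qtgt_concat qr) => _ -> _ _; apply/eqP.
have [u pu] := qconcat_some pq; have [pq' su au tu] := qtgt_concat pu.
rewrite pu /=.
have [qr|nqr] := eqVneq (qtgt q) (qsrc r); last first.
  rewrite (qconcat_none (elimN eqP nqr)) /= qconcat_none // tu.
  exact/eqP.
have [w qw] := qconcat_some qr; have [qr' sw aw tw] := qtgt_concat qw.
rewrite qw /=.
have [y py] : exists y, qconcat p w = Some y by apply: qconcat_some; rewrite sw.
have [z uz] : exists z, qconcat u r = Some z by apply: qconcat_some; rewrite tu.
rewrite py uz; congr Some.
have [_ sy ay _] := qtgt_concat py; have [_ sz az _] := qtgt_concat uz.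
by apply: qpath_inj; rewrite ?sy ?sz ?su // ay az aw au catA.
Qed.

End Paths.

Section PathAlgebra.
Variables (K : fieldType) (Q : quiver).
Local Notation P := (qpath Q).

Definition pathalg : Type := {ffun P -> K^o}.
HB.instance Definition _ := Vector.on pathalg.

Implicit Types x y z : pathalg.

Definition bpath (p : P) : pathalg := [ffun q => (q == p)%:R].

Lemma bpathE p q : bpath p q = (q == p)%:R.
Proof. exact: ffunE. Qed.

Definition pmul x y : pathalg :=
  [ffun p => \sum_q \sum_(r | qconcat q r == Some p) (x q : K) * y r].

Definition pone : pathalg := [ffun p => (qarr p == [::])%:R].

Lemma pathalg_sum x : x = \sum_p x p *: bpath p.
Proof.
apply/ffunP => q; rewrite sum_ffunE (bigD1 q) //= big1 ?addr0 => [|p pq].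
  by rewrite !ffunE eqxx /GRing.scale /= mulr1.
by rewrite !ffunE eq_sym (negPf pq) /GRing.scale /= mulr0.
Qed.

Fact pmulDl : left_distributive pmul +%R.
Proof.
move=> x y z; apply/ffunP => p; rewrite !ffunE -big_split; apply: eq_bigr => q _.
by rewrite -big_split; apply: eq_bigr => r _; rewrite ffunE mulrDl.
Qed.
Fact pmulDr : right_distributive pmul +%R.
Proof.
move=> x y z; apply/ffunP => p; rewrite !ffunE -big_split; apply: eq_bigr => q _.
by rewrite -big_split; apply: eq_bigr => r _; rewrite ffunE mulrDr.
Qed.
Fact pscaleAl (c : K) x y : c *: pmul x y = pmul (c *: x) y.
Proof.
apply/ffunP => p; rewrite !ffunE scaler_sumr; apply: eq_bigr => q _.
rewrite scaler_sumr; apply: eq_bigr => r _.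
by rewrite ffunE /GRing.scale /= mulrA.
Qed.
Fact pscaleAr (c : K) x y : c *: pmul x y = pmul x (c *: y).
Proof.
apply/ffunP => p; rewrite !ffunE scaler_sumr; apply: eq_bigr => q _.
rewrite scaler_sumr; apply: eq_bigr => r _.
by rewrite ffunE /GRing.scale /= mulrCA.
Qed.

Lemma bpathM p q : pmul (bpath p) (bpath q) = oapp bpath 0 (qconcat p q).
Proof.
apply/ffunP => u; rewrite ffunE (bigD1 p) //= [X in _ + X]big1 ?addr0; last first.
  by move=> v vp; rewrite big1 // => r _; rewrite bpathE (negPf vp) mul0r.
case pq: (qconcat p q) => [w|] /=.
  rewrite [bpath w u]bpathE; have [->|uw] := eqVneq u w.
    rewrite (bigD1 q) ?pq //= big1 ?addr0 ?bpathE ?eqxx ?mulr1 //.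
    by move=> r /andP[_ rq]; rewrite !bpathE (negPf rq) mulr0.
  rewrite big1 // => r /eqP pr; rewrite !bpathE.
  case: (r =P q) => [rq|]; last by rewrite mulr0.
  by move: pr; rewrite rq pq => -[wu]; rewrite wu eqxx in uw.
rewrite [RHS]ffunE big1 // => r /eqP pr; rewrite !bpathE.
by case: (r =P q) pr => [->|_ _]; rewrite ?pq // mulr0.
Qed.

Lemma pmul_suml (I : Type) (r : seq I) (F : I -> pathalg) y :
  pmul (\sum_(i <- r) F i) y = \sum_(i <- r) pmul (F i) y.
Proof.
elim: r => [|i r IH]; last by rewrite !big_cons pmulDl IH.
by rewrite !big_nil -[X in pmul X y](scale0r (0 : pathalg)) -pscaleAl scale0r.
Qed.
Lemma pmul_sumr (I : Type) (r : seq I) (F : I -> pathalg) x :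
  pmul x (\sum_(i <- r) F i) = \sum_(i <- r) pmul x (F i).
Proof.
elim: r => [|i r IH]; last by rewrite !big_cons pmulDr IH.
by rewrite !big_nil -[X in pmul x X](scale0r (0 : pathalg)) -pscaleAr scale0r.
Qed.
Lemma pmul0x y : pmul 0 y = 0.
Proof. by have := pmul_suml [::] (fun _ : nat => 0) y; rewrite !big_nil. Qed.
Lemma pmulx0 x : pmul x 0 = 0.
Proof. by have := pmul_sumr [::] (fun _ : nat => 0) x; rewrite !big_nil. Qed.

Fact pmulA : associative pmul.
Proof.
move=> x y z; rewrite [x]pathalg_sum !pmul_suml; apply: eq_bigr => p _.
rewrite -!pscaleAl; congr (_ *: _).
rewrite [y]pathalg_sum pmul_suml !pmul_sumr pmul_suml; apply: eq_bigr => q _.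
rewrite -!(pscaleAl, pscaleAr); congr (_ *: _).
rewrite [z]pathalg_sum !pmul_sumr; apply: eq_bigr => r _.
rewrite -!pscaleAr; congr (_ *: _).
rewrite !bpathM; have := qconcatA p q r.
case: (qconcat q r) => [u|]; case: (qconcat p q) => [v|] /= E.
- by rewrite !bpathM E.
- by rewrite bpathM E pmul0x.
- by rewrite bpathM -E pmulx0.
- by rewrite pmulx0 pmul0x.
Qed.

Definition evert (i : vert Q) : pathalg := bpath (qtriv i).
Definition earr (a : arr Q) : pathalg := bpath (qsingle a).

Fact evert_sum : \sum_i evert i = pone.
Proof.
apply/ffunP => p; rewrite sum_ffunE ffunE (bigD1 (qsrc p)) //=.
rewrite big1 ?addr0 => [|i ip]; rewrite ffunE; last first.
  by case: eqP => // pi; rewrite pi eqxx in ip.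
congr (_%:R); congr (nat_of_bool _); apply/eqP/eqP => [->//|p0].
exact: qpath_inj.
Qed.

Fact pmul1x : left_id pone pmul.
Proof.
move=> x; rewrite [x]pathalg_sum pmul_sumr; apply: eq_bigr => p _.
rewrite -pscaleAr; congr (_ *: _).
rewrite -evert_sum pmul_suml (bigD1 (qsrc p)) //= big1 ?addr0 => [|i ip].
  rewrite bpathM; suff /eqP -> : qconcat (qtriv (qsrc p)) p == Some p by [].
  by rewrite qconcatE !eqxx.
by rewrite bpathM qconcat_none //; apply/eqP.
Qed.

Fact pmulx1 : right_id pone pmul.
Proof.
move=> x; rewrite [x]pathalg_sum pmul_suml; apply: eq_bigr => p _.
rewrite -pscaleAl; congr (_ *: _).
rewrite -evert_sum pmul_sumr (bigD1 (qtgt p)) //= big1 ?addr0 => [|i ip].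
  rewrite bpathM; suff /eqP -> : qconcat p (qtriv (qtgt p)) == Some p by [].
  by rewrite qconcatE !eqxx /= cats0.
by rewrite bpathM qconcat_none // => pi; rewrite pi eqxx in ip.
Qed.

HB.instance Definition _ := Vector_isFDAlg.Build K pathalg
  pmulA pmul1x pmulx1 pmulDl pmulDr pscaleAl pscaleAr.

Fact evertM i j : evert i ** evert j = if i == j then evert i else 0.
Proof.
rewrite [LHS]bpathM; case: eqP => [->|ij]; last by rewrite qconcat_none.
suff /eqP -> : qconcat (qtriv j) (qtriv j) == Some (qtriv j) by [].
by rewrite qconcatE !eqxx.
Qed.

Definition path_palg : palg K := PAlg pathalg _ evert evertM evert_sum.

Definition parallel_comb (i j : vert Q) (x : pathalg) : Prop :=
  forall p, x p != 0 -> qsrc p = i /\ qtgt p = j.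

Definition comb_length_ge2 (x : pathalg) : Prop :=
  forall p, x p != 0 -> (2 <= size (qarr p))%N.

Definition bound_quiver_algebra (R : pathalg -> Prop) : palg K :=
  quot_palg (L := path_palg) (ideal_gen_two_sided (A := pathalg) R).

End PathAlgebra.

Record triangular_algebra (K : fieldType) := TriangularAlgebra {
  tri_quiver :> quiver;
  tri_rel : pathalg K tri_quiver -> Prop;
  tri_relP : forall x, tri_rel x ->
    (exists i j, parallel_comb i j x) /\ comb_length_ge2 x
}.

Definition tri_ideal (K : fieldType) (L : triangular_algebra K) :
  {vspace pathalg K L} := ideal_gen (@tri_rel K L).

Definition tri_alg (K : fieldType) (L : triangular_algebra K) : palg K :=
  bound_quiver_algebra (@tri_rel K L).

Definition poset_iso d d' (S : finPOrderType d) (T : finPOrderType d') : Prop :=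
  exists2 f : S -> T, bijective f & forall x y, (f x <= f y)%O = (x <= y)%O.

Section Posets.
Variables (d : Order.disp_t) (S : finPOrderType d).
Implicit Types s t : S.

Definition is_min s : bool := [forall t, ~~ (t < s)%O].
Definition is_max s : bool := [forall t, ~~ (s < t)%O].
Definition covers s t : bool := (s < t)%O && [forall u, ~~ ((s < u)%O && (u < t)%O)].

(* An arrow (s, t) from s to t whenever t covers s. *)
Definition hasse_arr : Type := {c : S * S | covers c.1 c.2}.
HB.instance Definition _ := Finite.on hasse_arr.
Definition hasse_src (a : hasse_arr) : S := (val a).1.
Definition hasse_tgt (a : hasse_arr) : S := (val a).2.

Lemma hasse_walk_le i p : walk hasse_src hasse_tgt i p ->
  (i <= walk_end hasse_tgt i p)%O /\ (p != [::] -> (i < walk_end hasse_tgt i p)%O).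
Proof.
elim: p i => [|a p IH] i //= /andP[/eqP <- /IH[le_a _]].
have lt_a : (hasse_src a < hasse_tgt a)%O by case/andP: (valP a).
have lt_i := lt_le_trans lt_a le_a.
by split=> [|_]; rewrite ?(ltW lt_i).
Qed.

Fact hasse_acyclic i p : walk hasse_src hasse_tgt i p ->
  walk_end hasse_tgt i p = i -> p = [::].
Proof.
move=> /hasse_walk_le[_]; case: eqP => // _ /(_ isT) lt_i ei.
by rewrite ei ltxx in lt_i.
Qed.

Definition hasse_quiver : quiver := Quiver hasse_src hasse_tgt hasse_acyclic.

Definition incidence_algebra (K : fieldType) : palg K :=
  bound_quiver_algebra (fun x : pathalg K hasse_quiver =>
    exists p q : qpath hasse_quiver,
      [/\ qsrc p = qsrc q, qtgt p = qtgt q & x = bpath K p - bpath K q]).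

Definition poset_cartan (s t : S) : nat := (t <= s)%O.

Definition poset_cox_mx (s t : S) : {poly int} :=
  'X * (poset_cartan s t)%:R + (poset_cartan t s)%:R.

Definition poset_coxeter_poly : {poly int} := fin_det poset_cox_mx.

Definition subtract_row (M : S -> S -> {poly int}) (s : S) :=
  fun i j => if i == s then M i j else M i j - M s j.
Definition subtract_col (M : S -> S -> {poly int}) (s : S) :=
  fun i j => if j == s then M i j else M i j - M i s.

Definition refined_coxeter_at (s : S) : {poly int} :=
  fin_det (fun i j : {i : S | i != s} =>
    subtract_col (subtract_row poset_cox_mx s) s (val i) (val j)).

Definition refined_coxeter_poly : {poly int} :=
  if [pick s : S] is Some s then refined_coxeter_at s else 0.

(* The vertices of the Hasse quiver are arranged in a cycle by f; the edge
   between f i and f (i + 1) is clockwise (f i -> f (i + 1)) iff cw i. A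
   maximal clockwise run ends where a clockwise arrow is followed by an
   anti-clockwise one, and vice versa. *)
Definition type_A_tilde : Prop :=
  exists (n : nat) (f : 'I_n -> S) (cw : 'I_n -> bool),
  [/\ bijective f,
      forall s t, covers s t <->
        exists i, (s, t) = if cw i then (f i, f (ordS i)) else (f (ordS i), f i) &
      exists2 k : nat, (2 <= k)%N &
        #|[set i | cw i && ~~ cw (ordS i)]| = k /\
        #|[set i | ~~ cw i && cw (ordS i)]| = k].

End Posets.

Section PosetDelete.
Variables (d : Order.disp_t) (X : finPOrderType d) (v : X).

Definition poset_del : Type := {x : X | x != v}.
HB.instance Definition _ := Finite.on poset_del.
HB.instance Definition _ := SubType.on poset_del.
HB.instance Definition _ := [SubChoice_isSubPOrder of poset_del by <: with d].

End PosetDelete.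

Section PosetInsertion.
Variables (d d' : Order.disp_t) (X : finPOrderType d) (v : X) (S : finPOrderType d').

Definition poset_ins : Type := {x : X + S | x != inl v}.
HB.instance Definition _ := Finite.on poset_ins.

Definition ins_le (x y : poset_ins) : bool :=
  match val x, val y with
  | inl a, inl b => (a <= b)%O
  | inr s, inr t => (s <= t)%O
  | inl a, inr _ => (a <= v)%O
  | inr _, inl b => (v <= b)%O
  end.

Fact ins_le_refl : reflexive ins_le.
Proof. by case=> [[a|s] i]; rewrite /ins_le /=. Qed.

Fact ins_le_anti : antisymmetric ins_le.
Proof.
case=> [[a|s] i] [[b|t] j]; rewrite /ins_le /= => le2; apply: val_inj => /=.
- by congr inl; apply: le_anti.
- by move: i; rewrite (le_anti le2) eqxx.
- by move: j; rewrite -(le_anti le2) eqxx.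
- by congr inr; apply: le_anti.
Qed.

Fact ins_le_trans : transitive ins_le.
Proof.
case=> [[b|t] j] [[a|s] i] [[c|u] k]; rewrite /ins_le /= => // h1 h2.
- exact: le_trans h1 h2.
- exact: le_trans h1 h2.
- exact: le_trans h1 h2.
- by move: j; have -> : b = v; [apply: le_anti; rewrite h1 h2|rewrite eqxx].
- exact: le_trans h1 h2.
- exact: le_trans h1 h2.
Qed.

HB.instance Definition _ :=
  Order.Le_isPOrder.Build d poset_ins ins_le_refl ins_le_anti ins_le_trans.

End PosetInsertion.

Inductive class_C : forall d : Order.disp_t, finPOrderType d -> Prop :=
| class_C_empty d (S : finPOrderType d) : #|S| = 0%N -> class_C S
| class_C_ins d d' d'' (X : finPOrderType d) (v : X) (S : finPOrderType d')
    (T : finPOrderType d'') :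
    class_C (poset_del v) -> type_A_tilde S ->
    poset_iso (poset_ins v S) T -> class_C T.

Section AlgebraInsertion.
Variables (K : fieldType) (L : triangular_algebra K) (v : vert L).
Variables (d : Order.disp_t) (S : finPOrderType d).
Local Notation H := (hasse_quiver S).

Lemma no_loop (Q : quiver) (a : arr Q) : src a != tgt a.
Proof.
apply/eqP => e; have := @acyclic Q (src a) [:: a].
by rewrite /= eqxx /walk_end /= => /(_ isT (esym e)).
Qed.

(* Candidate vertices and arrows; the actual ones are those satisfying
   ins_vert_ok and ins_arr_ok. *)
Definition ins_vert_ok (x : vert L + S) : bool := x != inl v.
Definition ins_vert : Type := {x : vert L + S | ins_vert_ok x}.
HB.instance Definition _ := Finite.on ins_vert.

Inductive ins_raw_arr :=
  | Outer of arr L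
  | Inner of arr H
  | Into of arr L & S
  | From of S & arr L.

Definition raw_code (a : ins_raw_arr) : arr L + arr H + (arr L * S + S * arr L) :=
  match a with
  | Outer g => inl (inl g)
  | Inner c => inl (inr c)
  | Into a s => inr (inl (a, s))
  | From s b => inr (inr (s, b))
  end.
Definition raw_decode (x : arr L + arr H + (arr L * S + S * arr L)) : ins_raw_arr :=
  match x with
  | inl (inl g) => Outer g
  | inl (inr c) => Inner c
  | inr (inl (a, s)) => Into a s
  | inr (inr (s, b)) => From s b
  end.
Fact raw_codeK : cancel raw_code raw_decode. Proof. by case. Qed.
HB.instance Definition _ := Finite.copy ins_raw_arr (can_type raw_codeK).

Definition ins_arr_ok (x : ins_raw_arr) : bool :=
  match x with
  | Outer g => (src g != v) && (tgt g != v)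
  | Inner _ => true
  | Into a s => (tgt a == v) && is_min s
  | From s b => (src b == v) && is_max s
  end.

Definition raw_src (x : ins_raw_arr) : vert L + S :=
  match x with
  | Outer g => inl (src g)
  | Inner c => inr (src c)
  | Into a _ => inl (src a)
  | From s _ => inr s
  end.
Definition raw_tgt (x : ins_raw_arr) : vert L + S :=
  match x with
  | Outer g => inl (tgt g)
  | Inner c => inr (tgt c)
  | Into _ s => inr s
  | From _ b => inl (tgt b)
  end.

Definition ins_arr : Type := {x : ins_raw_arr | ins_arr_ok x}.
HB.instance Definition _ := Finite.on ins_arr.

Fact raw_src_ok x : ins_arr_ok x -> ins_vert_ok (raw_src x).
Proof.
rewrite /ins_vert_ok; case: x => [g|c|a s|s b] //= /andP[] // /eqP av _.
by rewrite (inj_eq (@inl_inj _ _)) -av no_loop.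
Qed.
Fact raw_tgt_ok x : ins_arr_ok x -> ins_vert_ok (raw_tgt x).
Proof.
rewrite /ins_vert_ok; case: x => [g|c|a s|s b] //= /andP[] // /eqP bv _.
by rewrite (inj_eq (@inl_inj _ _)) -bv eq_sym no_loop.
Qed.

Definition ins_src (a : ins_arr) : ins_vert := Sub (raw_src (val a)) (raw_src_ok (valP a)).
Definition ins_tgt (a : ins_arr) : ins_vert := Sub (raw_tgt (val a)) (raw_tgt_ok (valP a)).

(* Collapsing S to v. *)
Definition collapse_vert (x : vert L + S) : vert L := if x is inl i then i else v.
Definition collapse_arr (x : ins_raw_arr) : seq (arr L) :=
  match x with
  | Outer g => [:: g]
  | Inner _ => [::]
  | Into a _ => [:: a]
  | From _ b => [:: b]
  end.

Lemma collapse_walk i p : walk ins_src ins_tgt i p ->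
  let cp := flatten [seq collapse_arr (val a) | a <- p] in
  walk (@src L) (@tgt L) (collapse_vert (val i)) cp /\
  walk_end (@tgt L) (collapse_vert (val i)) cp =
    collapse_vert (val (walk_end ins_tgt i p)).
Proof.
elim: p i => [|a p IH] i //= /andP[/eqP <- /IH[]] {IH}.
rewrite {3}/walk_end /= -/(walk_end ins_tgt _ _).
case: a => [[g|c|a s|s b] ok] /= w e; split=> //.
- by rewrite eqxx.
- by rewrite eqxx (eqP (proj1 (andP ok))).
- by rewrite (eqP (proj1 (andP ok))); exact: e.
- by rewrite w (eqP (proj1 (andP ok))) eqxx.
Qed.

Lemma inner_walk i p : walk ins_src ins_tgt i p ->
  flatten [seq collapse_arr (val a) | a <- p] = [::] -> p != [::] ->
  exists s t, [/\ val i = inr s, val (walk_end ins_tgt i p) = inr t & (s < t)%O].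
Proof.
elim: p i => [|a p IH] i //= /andP[/eqP <- w].
rewrite /walk_end /= -/(walk_end ins_tgt _ _).
case: a w => [[g|c|a s|s b] ok] //= w e _.
have lt_c : ((src c : S) < tgt c)%O by case/andP: (valP c).
have [p0|p0] := eqVneq p [::].
  by exists (src c), (tgt c); rewrite p0.
have [s [t [[<-] -> lt_st]]] := IH _ w e p0.
by exists (src c), t; split=> //; apply: lt_trans lt_c lt_st.
Qed.

Fact ins_acyclic i p : walk ins_src ins_tgt i p ->
  walk_end ins_tgt i p = i -> p = [::].
Proof.
move=> w ei; apply/eqP; apply: contraT => p0.
have [cw ce] := collapse_walk w; rewrite ei in ce.
have [s [t [si ti]]] := inner_walk w (acyclic cw ce) p0.
by move: ti; rewrite ei si => -[->]; rewrite ltxx.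
Qed.

Definition ins_quiver : quiver := Quiver ins_src ins_tgt ins_acyclic.

Local Notation KQ' := (pathalg K ins_quiver).

(* The idempotent of a vertex and the class of an arrow, read as 0 if this
   vertex or arrow does not exist. *)
Definition ivert (x : vert L + S) : KQ' :=
  if insub x is Some i then evert K (i : vert ins_quiver) else 0.
Definition iarr (x : ins_raw_arr) : KQ' :=
  if insub x is Some a then earr K (a : arr ins_quiver) else 0.

Local Notation "\cat_ ( a <- p ) F" := (\big[fdmul/(fdone : KQ')]_(a <- p) F)
  (at level 41, F at level 41, a, p at level 50).

(* A path of the Hasse quiver of S, as an element of KQ' *)
Definition ipath (q : qpath H) : KQ' :=
  ivert (inr (qsrc q)) ** \cat_(c <- qarr q) iarr (Inner c).

(* (p, s), for a path p of positive length ending at v. As there are no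
   oriented cycles, only the last arrow of p ends at v. *)
Definition path_into (p : qpath L) (s : S) : KQ' :=
  ivert (inl (qsrc p)) **
  \cat_(a <- qarr p) (if tgt a == v then iarr (Into a s) else iarr (Outer a)).

(* (s, p), for a path p of positive length starting at v *)
Definition path_from (s : S) (p : qpath L) : KQ' :=
  ivert (inr s) **
  \cat_(a <- qarr p) (if src a == v then iarr (From s a) else iarr (Outer a)).

(* The path obtained from a path p neither starting nor ending at v by
   inserting q when passing through v *)
Definition path_through (q : qpath H) (p : qpath L) : KQ' :=
  ivert (inl (qsrc p)) **
  \cat_(a <- qarr p)
    (if tgt a == v then iarr (Into a (qsrc q)) ** ipath q
     else if src a == v then iarr (From (qtgt q) a)
     else iarr (Outer a)).

Definition minmax_path (q : qpath H) : Prop :=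
  is_min (qsrc q : S) /\ is_max (qtgt q : S).

(* As the elements of tri_ideal L only involve paths of length at least 2, the
   values of path_into and path_from at trivial paths are irrelevant. *)
Inductive ins_rel : KQ' -> Prop :=
  | Ins_1a (x : pathalg K L) (i : vert L) (s : S) :
      x \in tri_ideal L -> parallel_comb i v x -> is_min s ->
      ins_rel (\sum_p x p *: path_into p s)
  | Ins_1b (x : pathalg K L) (j : vert L) (s : S) :
      x \in tri_ideal L -> parallel_comb v j x -> is_max s ->
      ins_rel (\sum_p x p *: path_from s p)
  | Ins_2a (q1 q2 : qpath H) :
      qsrc q1 = qsrc q2 -> qtgt q1 = qtgt q2 ->
      ins_rel (ipath q1 - ipath q2)
  | Ins_2b (a : arr L) (q1 q2 : qpath H) :
      tgt a = v -> is_min (qsrc q1 : S) -> is_min (qsrc q2 : S) ->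
      qtgt q1 = qtgt q2 ->
      ins_rel (iarr (Into a (qsrc q1)) ** ipath q1 -
               iarr (Into a (qsrc q2)) ** ipath q2)
  | Ins_2c (b : arr L) (q1 q2 : qpath H) :
      src b = v -> is_max (qtgt q1 : S) -> is_max (qtgt q2 : S) ->
      qsrc q1 = qsrc q2 ->
      ins_rel (ipath q1 ** iarr (From (qtgt q1) b) -
               ipath q2 ** iarr (From (qtgt q2) b))
  | Ins_2d (a b : arr L) (q1 q2 : qpath H) :
      tgt a = v -> src b = v -> minmax_path q1 -> minmax_path q2 ->
      ins_rel (iarr (Into a (qsrc q1)) ** ipath q1 ** iarr (From (qtgt q1) b) -
               iarr (Into a (qsrc q2)) ** ipath q2 ** iarr (From (qtgt q2) b))
  | Ins_3 (x : pathalg K L) (i j : vert L) (q : qpath L -> qpath H) :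
      x \in tri_ideal L -> parallel_comb i j x -> i != v -> j != v ->
      (forall p, minmax_path (q p)) ->
      ins_rel (\sum_p x p *: path_through (q p) p).

(* Inserting the empty poset yields (1 - e_v) L (1 - e_v). *)
Definition insertion : palg K :=
  if #|S| == 0%N then @corner K (tri_alg L) v else bound_quiver_algebra ins_rel.

End AlgebraInsertion.

(* Main.v *)
From HB Require Import structures.
Require Import Defs.
From mathcomp Require Import all_boot all_order all_fingroup all_algebra.
From mathcomp Require Import cyclotomic ring zify.

Set Implicit Arguments.
Unset Strict Implicit.
Unset Printing Implicit Defensive.

Import Order.TTheory GRing.Theory Num.Theory.
Local Open Scope ring_scope.

(** Write M_S = x C_S + C_S^T for a poset S. Two facts on S suffice.

    The first is that S is balanced: some vector z of total weight zero satisfies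
    M_S z = c 1 with c nonzero, 1 being the vector with all entries 1. All
    elements of an inserted poset S are related in the same way to each vertex
    outside S, so the matrix x C + C^T of an insertion has constant rows or
    columns in its two off-diagonal blocks. The combination z of its columns in S
    is then 0 outside S and c on S, and subtracting multiples of it clears one of
    these blocks: the determinant is the product of those of the two diagonal
    blocks (det_inserted). Moreover z, restricted to the complement of a point,
    is in the kernel of the matrix that defines the refined Coxeter polynomial,
    which therefore vanishes (balanced_refined), and the matrix of an insertion is
    balanced as soon as its two diagonal blocks are (balanced_inserted).

    The second is that the Coxeter polynomial of S is a product of cyclotomic
    polynomials; by the factorization it is inherited by insertions of a balanced
    poset. Both facts thus hold on the class C by induction (class_C_props) once
    they hold for the posets of type A tilde.

    For these, let B be the identity minus the matrix of the covering relation.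
    As the cycle has at least two sinks, every interval of S is a chain, and B is
    the inverse of C (cartan_euler). Hence
    B M_S B^T = x B^T + B, and this tridiagonal cyclic matrix is a product of two
    factors of the form 1 - (weighted cyclic shift), which gives the determinant
    (1 - x^p) (1 - x^q), p and q being the numbers of clockwise and anticlockwise
    arrows (det_cycle_euler). Each vertex of a cycle has two neighbours, so
    (B + B^T) 1 = 0, and z = B^T 1 shows that S is balanced (cycle_balanced).

    It remains to see that the Cartan matrix of an insertion into an algebra, with
    quiver Q and ideal I, has the block shape used above. Its entries are
    dimensions of the components e_j A e_i (cartan_peirce). Collapsing S to v maps
    paths of the quiver of the insertion to paths of Q and the ideal of the
    insertion into I. Fixing source and target, every path of Q has a lift, any
    path of the insertion is congruent to the lift of its image thanks to the
    relations Ins_2a to Ins_2d, and the lift maps I into the ideal of the insertion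
    thanks to the relations Ins_1a, Ins_1b and Ins_3; so the corresponding
    components have the same dimension (cartan_collapse, cartan_insertion). *)

(** * Determinants over finite index types *)

Lemma sum_delta (R : pzSemiRingType) (T : finType) (F : T -> R) t :
  \sum_k (k == t)%:R * F k = F t.
Proof.
by rewrite (bigD1 t) //= eqxx mul1r big1 ?addr0 // => k /negPf->; rewrite mul0r.
Qed.

Section FinDet.
Variable R : comPzRingType.
Implicit Types A B T : finType.

Lemma det_mxsub_bij n (M : 'M[R]_n) (g : 'I_n -> 'I_n) :
  bijective g -> \det (mxsub g g M) = \det M.
Proof.
move=> gb; pose s := perm (bij_inj gb).
have -> : mxsub g g M = row_perm s (col_perm s M).
  by apply/matrixP => i j; rewrite !mxE !permE.
rewrite row_permE col_permE !det_mulmx !det_perm odd_permV mulrCA -signr_addb.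
by rewrite addbb mulr1.
Qed.

Lemma fin_det_ord T (M : T -> T -> R) n (g : 'I_n -> T) :
  bijective g -> fin_det M = \det (\matrix_(i, j) M (g i) (g j)).
Proof.
move=> gb; have eT : #|T| = n by rewrite -[RHS]card_ord (bij_eq_card gb).
case: n / eT g gb => g gb.
pose h i := enum_rank (g i).
have hb : bijective h := bij_comp (Bijective enum_rankK enum_valK) gb.
rewrite /fin_det -(det_mxsub_bij _ hb); congr (\det _).
by apply/matrixP => i j; rewrite !mxE /h !enum_rankK.
Qed.

Lemma eq_fin_det T (M N : T -> T -> R) :
  (forall i j, M i j = N i j) -> fin_det M = fin_det N.
Proof.
by move=> MN; congr (\det _); apply/matrixP => i j; rewrite !mxE MN.
Qed.

Lemma fin_det_bij A B (g : A -> B) (M : B -> B -> R) :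
  bijective g -> fin_det (fun i j => M (g i) (g j)) = fin_det M.
Proof.
move=> gb; have eb : bijective (fun i : 'I_#|A| => enum_val i).
  exact: enum_val_bij.
by rewrite (fin_det_ord M (bij_comp gb eb)).
Qed.

Lemma fin_det_tr T (M : T -> T -> R) : fin_det (fun i j => M j i) = fin_det M.
Proof.
by rewrite /fin_det -det_tr; congr (\det _); apply/matrixP => i j; rewrite !mxE.
Qed.

Lemma fin_det_mul T (M N : T -> T -> R) :
  fin_det (fun i j => \sum_k M i k * N k j) = fin_det M * fin_det N.
Proof.
rewrite /fin_det -det_mulmx; congr (\det _); apply/matrixP => i j.
rewrite !mxE (reindex _ (onW_bij _ (@enum_val_bij T))) /=.
by apply: eq_bigr => k _; rewrite !mxE.
Qed.

Lemma fin_det_scalar T (c : R) :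
  fin_det (fun i j : T => c *+ (i == j)) = c ^+ #|T|.
Proof.
rewrite /fin_det -det_scalar; congr (\det _); apply/matrixP => i j.
by rewrite !mxE (inj_eq enum_val_inj).
Qed.

Lemma fin_det0 T (M : T -> T -> R) : #|T| = 0%N -> fin_det M = 1.
Proof.
move=> T0; have M1 i j : M i j = 1 *+ (i == j).
  by have := card0_eq T0 i; rewrite inE.
by rewrite (eq_fin_det M1) fin_det_scalar T0.
Qed.

Definition sum_enum A B (i : 'I_(#|A| + #|B|)) : A + B :=
  match split i with inl j => inl (enum_val j) | inr k => inr (enum_val k) end.

Lemma sum_enum_bij A B : bijective (@sum_enum A B).
Proof.
pose h (x : A + B) := match x with
  inl a => lshift _ (enum_rank a) | inr b => rshift _ (enum_rank b) end.
exists h => [i|[a|b]]; rewrite /sum_enum /h.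
- by case: split_ordP => j ->; rewrite enum_valK.
- by case: split_ordP => j /eqP; rewrite ?eq_shift // => /eqP <-; rewrite enum_rankK.
- by case: split_ordP => j /eqP; rewrite ?eq_shift // => /eqP <-; rewrite enum_rankK.
Qed.

Lemma fin_det_ublock A B (M : A + B -> A + B -> R) :
  (forall a b, M (inr b) (inl a) = 0) ->
  fin_det M = fin_det (fun i j => M (inl i) (inl j)) *
              fin_det (fun i j => M (inr i) (inr j)).
Proof.
move=> M0; rewrite (fin_det_ord M (@sum_enum_bij A B)).
rewrite -(det_ublock _ (\matrix_(i, j) M (inl (enum_val i)) (inr (enum_val j)))).
set U := (\matrix_(i, j) M _ _); rewrite -[U]submxK.
congr (\det (block_mx _ _ _ _)); apply/matrixP => i j; rewrite !mxE /sum_enum.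
- by rewrite !(unsplitK (inl _)).
- by rewrite (unsplitK (inl _)) (unsplitK (inr _)).
- by rewrite (unsplitK (inl _)) (unsplitK (inr _)) M0.
- by rewrite !(unsplitK (inr _)).
Qed.

End FinDet.

Lemma fin_det_ker (R : idomainType) (T : finType) (M : T -> T -> R) (z : T -> R) :
  (exists t, z t != 0) -> (forall i, \sum_j M i j * z j = 0) -> fin_det M = 0.
Proof.
move=> [t zt] Mz; apply/eqP; rewrite /fin_det -det_tr; apply/det0P.
exists (\row_i z (enum_val i)).
  apply: contra zt => /eqP/rowP/(_ (enum_rank t)).
  by rewrite !mxE enum_rankK => ->.
apply/rowP => i; rewrite !mxE -[RHS](Mz (enum_val i)).
rewrite [RHS](reindex _ (onW_bij _ (@enum_val_bij T))) /=.
by apply: eq_bigr => k _; rewrite !mxE mulrC.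
Qed.

(** * Balanced matrices *)

Section Balanced.
Variable R : idomainType.

(** The condition on S under which inserting S multiplies the determinant of
    x C + C^T by that of S; it implies that the refined Coxeter polynomial
    vanishes. *)
Definition balanced (T : finType) (M : T -> T -> R) : Prop :=
  exists c z, [/\ c != 0, forall i, \sum_j M i j * z j = c & \sum_j z j = 0].

(** The shape of the matrix x C + C^T after a vertex has been replaced by S: all
    elements of S are related in the same way to the vertices outside S. *)
Definition inserted_mx (A S : finType) (N : A -> A -> R) (u w : A -> R)
    (M : S -> S -> R) (x y : A + S) : R :=
  match x, y with
  | inl a, inl b => N a b
  | inl a, inr _ => u a
  | inr _, inl b => w b
  | inr s, inr t => M s t
  end.

Section Insertion.
Variables (A S : finType) (N : A -> A -> R) (u w : A -> R) (M : S -> S -> R).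

Lemma det_inserted : balanced M ->
  fin_det (inserted_mx N u w M) = fin_det N * fin_det M.
Proof.
move=> [c [z [c0 Mz z0]]].
(* Right multiplication by G multiplies the column b of A by c and subtracts
   w b times the combination z of the columns of S, which is 0 on A and c on S:
   the lower left block becomes zero. *)
pose G (x y : A + S) : R := match x, y with
  | inl a, inl b => c *+ (a == b)
  | inl a, inr _ => 0
  | inr s, inl b => - (z s * w b)
  | inr s, inr t => 1 *+ (s == t) end.
have detG : fin_det G = c ^+ #|A|.
  rewrite -fin_det_tr fin_det_ublock //= (@fin_det_tr _ _ (fun i j => c *+ (i == j))).
  rewrite (@fin_det_tr _ _ (fun i j => 1 *+ (i == j))) !fin_det_scalar.
  by rewrite expr1n mulr1.
apply: (mulIf (expf_neq0 #|A| c0)); rewrite -{1}detG -fin_det_mul.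
have kron (T : finType) (f : T -> R) (d : R) t :
    \sum_k f k * (d *+ (k == t)) = f t * d.
  rewrite (bigD1 t) //= eqxx big1 ?addr0 // => k /negPf->.
  by rewrite mulr0n mulr0.
rewrite fin_det_ublock => [|a s]; last first.
  rewrite big_sumType /= kron.
  under eq_bigr do rewrite mulrN mulrA.
  by rewrite sumrN -mulr_suml Mz mulrC subrr.
rewrite mulrAC; congr (_ * _); last first.
  apply: eq_fin_det => s t; rewrite big_sumType /= kron mulr1 big1 ?add0r //.
  by move=> k _; rewrite mulr0.
rewrite -fin_det_scalar -fin_det_mul; apply: eq_fin_det => a b.
rewrite big_sumType /=; under [X in _ + X]eq_bigr do rewrite mulrN mulrCA.
by rewrite sumrN -mulr_suml z0 mul0r subr0.
Qed.

(** If N z = c 1 and M z' = c' 1, and e is the common value on S of the image of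
    z, then the vector equal to c' z on A and (c - e) z' on S is sent to
    c c' 1. *)
Lemma balanced_inserted : balanced N -> balanced M ->
  balanced (inserted_mx N u w M).
Proof.
move=> [c [z [c0 Nz z0]]] [c' [z' [c0' Mz z0']]].
pose e := \sum_a w a * z a.
exists (c * c').
exists (fun x => match x with inl a => c' * z a | inr s => (c - e) * z' s end).
split; first by rewrite mulf_neq0.
- case=> [a|s]; rewrite big_sumType /=.
    under eq_bigr do rewrite mulrCA.
    under [X in _ + X]eq_bigr do rewrite mulrCA.
    by rewrite -!mulr_sumr Nz z0' !mulr0 addr0 mulrC.
  under eq_bigr do rewrite mulrCA.
  under [X in _ + X]eq_bigr do rewrite mulrCA.
  by rewrite -!mulr_sumr Mz -/e; ring.
- by rewrite big_sumType /= -!mulr_sumr z0 z0' !mulr0 addr0.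
Qed.

End Insertion.

Lemma balanced_bij (A B : finType) (g : A -> B) (M : B -> B -> R) :
  bijective g -> balanced M -> balanced (fun i j => M (g i) (g j)).
Proof.
move=> gb [c [z [c0 Mz z0]]]; exists c, (z \o g); split=> //.
- by move=> i; rewrite -(Mz (g i)) [RHS](reindex _ (onW_bij _ gb)).
- by apply: etrans z0; rewrite [RHS](reindex _ (onW_bij _ gb)).
Qed.

Lemma eq_balanced (T : finType) (M N : T -> T -> R) :
  (forall i j, M i j = N i j) -> balanced M -> balanced N.
Proof.
move=> MN [c [z [c0 Mz z0]]]; exists c, z; split=> // i.
by rewrite -(Mz i); apply: eq_bigr => j _; rewrite MN.
Qed.

Lemma balanced_void (T : finType) (M : T -> T -> R) : #|T| = 0%N -> balanced M.
Proof.
move=> T0; exists 1, (fun _ => 0); split; rewrite ?oner_neq0 ?big1 // => i.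
by have := card0_eq T0 i; rewrite inE.
Qed.

End Balanced.

(** Off s, the vector z of a balanced matrix is in the kernel of the matrix
    obtained by subtracting the row and the column of s. *)
Lemma balanced_refined d (S : finPOrderType d) :
  balanced (@poset_cox_mx _ S) -> refined_coxeter_poly S = 0.
Proof.
move=> [c [z [c0 Mz z0]]]; rewrite /refined_coxeter_poly.
case: pickP => // s _.
have subE i j (si : i != s) : j != s ->
    subtract_col (subtract_row (@poset_cox_mx _ S) s) s i j =
    poset_cox_mx i j - poset_cox_mx s j - (poset_cox_mx i s - poset_cox_mx s s).
  by rewrite /subtract_col /subtract_row (negPf si) => /negPf->.
have subsum (F : S -> {poly int}) :
    \sum_(j : {i | i != s}) F (val j) = \sum_(j | j != s) F j.
  rewrite [RHS](reindex_omap (val : {i | i != s} -> S) insub) /=; last first.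
    by move=> i iv; rewrite insubT.
  by apply: eq_bigl => i; rewrite valK eqxx (valP i).
apply: (@fin_det_ker _ _ _ (fun j => z (val j))).
  have [j /andP[js zj]|z_0] := pickP (fun j => (j != s) && (z j != 0)).
    by exists (Sub j js); rewrite SubK.
  have zs0 j : j != s -> z j = 0.
    by move=> js; have := z_0 j; rewrite js => /negbFE/eqP.
  have zs : z s = 0 by rewrite -z0 (bigD1 s) //= big1 ?addr0 // => j /zs0.
  case/eqP: c0; rewrite -(Mz s) big1 // => j _.
  by have [->|/zs0->] := eqVneq j s; rewrite ?zs mulr0.
move=> [i si] /=.
pose F j := (poset_cox_mx i j - poset_cox_mx s j
             - (poset_cox_mx i s - poset_cox_mx s s)) * z j.
rewrite (eq_bigr (fun j => F (val j))) => [|[j js] _]; last by rewrite subE.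
rewrite subsum; transitivity (\sum_j F j).
  by rewrite [RHS](bigD1 s) //= /F subrr mul0r add0r.
under eq_bigr do rewrite /F mulrBl mulrBl.
by rewrite !sumrB !Mz -mulr_sumr z0 mulr0 !subrr.
Qed.

(** * Determinants of orientations of a cycle *)

(** By expansion along the first column, which involves the first row, with entry
    1, and the last one, with entry - b i; the corresponding minors are
    triangular, with diagonal entries 1 and - b i. *)
Lemma det_one_sub_cycle (R : comPzRingType) m (b : 'I_m.+1 -> R) :
  \det (\matrix_(i, j) ((i == j)%:R - b i * (j == ordS i)%:R)) = 1 - \prod_i b i.
Proof.
set U := \matrix_(i, j) _.
have U0 i : U i ord0 = (i == ord0)%:R - b i * (i == ord_max)%:R.
  rewrite !mxE; congr (_ - _ * (nat_of_bool _)%:R); apply/eqP/eqP => /(congr1 val) /=.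
    move=> e; apply/val_inj => /=; have := ltn_ord i.
    rewrite ltnS leq_eqVlt => /orP[/eqP//|im].
    by move: e; rewrite modn_small.
  by move=> im; apply/val_inj; rewrite /= im modnn.
rewrite (expand_det_col _ ord0).
transitivity (cofactor U ord0 ord0 - b ord_max * cofactor U ord_max ord0).
  under eq_bigr do rewrite U0 mulrBl mulrAC [X in _ - X]mulrC.
  by rewrite sumrB !sum_delta.
rewrite /cofactor /= expr0 mul1r addn0.
rewrite -[\det (row' ord0 _)]det_tr (det_trig (A := _^T)); last first.
  apply/forallP => i; apply/forallP => j; apply/implyP => ij.
  rewrite !mxE -!val_eqE /= /bump !leq0n !add1n eqSS gtn_eqF // sub0r.
  have jm : (j.+2 <= m.+1)%N by have := ltn_ord j.
  have [jm'|jm'] := ltnP j.+2 m.+1.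
    by rewrite modn_small // eqSS ltn_eqF ?mulr0 ?oppr0 // ltnW.
  have -> : j.+2 = m.+1 by apply/eqP; rewrite eqn_leq jm.
  by rewrite modnn mulr0 oppr0.
rewrite big1 => [|i _]; last first.
  rewrite !mxE -!val_eqE /= /bump !leq0n !add1n eqxx.
  have im : (i.+2 <= m.+1)%N by have := ltn_ord i.
  have [im'|im'] := ltnP i.+2 m.+1.
    by rewrite modn_small // eqSS ltn_eqF // mulr0 subr0.
  have -> : i.+2 = m.+1 by apply/eqP; rewrite eqn_leq im.
  by rewrite modnn mulr0 subr0.
congr (_ - _); rewrite det_trig; last first.
  apply/forallP => i; apply/forallP => j; apply/implyP => ij.
  rewrite !mxE -!val_eqE /= /bump leq0n [(m <= i)%N]leqNgt ltn_ord add0n add1n.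
  rewrite modn_small ?ltnS // eqSS (gtn_eqF ij) mulr0 subr0.
  by rewrite ltn_eqF // ltnW.
have -> : \prod_(i < m) row' ord_max (col' ord0 U) i i =
    \prod_(i < m) (- b (widen_ord (leqnSn m) i)).
  apply: eq_bigr => i _.
  rewrite !mxE -!val_eqE /= /bump leq0n [(m <= i)%N]leqNgt ltn_ord add0n add1n.
  rewrite modn_small ?ltnS // eqxx ltn_eqF // sub0r mulr1; congr (- b _).
  by apply/val_inj; rewrite /= /bump leqNgt ltn_ord.
by rewrite prodrN card_ord signrMK big_ord_recr mulrC.
Qed.

Section CycleOrientation.
Variables (R : comPzRingType) (m : nat) (cw : 'I_m.+1 -> bool).
Local Notation n := m.+1.

(** The edge between i and i + 1 of a cycle is oriented from i to i + 1 when
    cw i holds and the other way round otherwise. This is the identity minus the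
    transposed adjacency matrix of the resulting quiver; if there are no oriented
    cycles, it is the inverse of the Cartan matrix of the path algebra. *)
Definition cycle_euler : 'M[R]_n := \matrix_(i, j)
  ((i == j)%:R - (cw j && (i == ordS j))%:R - (~~ cw i && (j == ordS i))%:R).

Local Notation B := cycle_euler.

(** With b i = x, c i = 1 at clockwise edges and b i = 1, c i = x at the other
    ones, x B^T + B factors as (1 - S^T c) (1 - b S), where S is the permutation
    matrix of the cyclic shift and b, c stand for diagonal matrices: as c b = x,
    the quadratic term is x S^T S = x. *)
Lemma det_cycle_euler (x : R) :
  \det (x *: B^T + B) = (1 - x ^+ #|[set i | cw i]|) * (1 - x ^+ #|[set i | ~~ cw i]|).
Proof.
pose b i : R := if cw i then x else 1.
pose c i : R := if cw i then 1 else x.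
pose U e : 'M[R]_n := \matrix_(i, j) ((i == j)%:R - e i * (j == ordS i)%:R).
have prodE (P : pred 'I_n) : \prod_i (if P i then x else 1) = x ^+ #|[set i | P i]|.
  by rewrite -big_mkcond /= prodr_const cardsE.
transitivity (\det ((U c)^T *m U b)); last first.
  rewrite det_mulmx det_tr !det_one_sub_cycle -!prodE mulrC; congr (_ * (1 - _)).
  by apply: eq_bigr => i _; rewrite /c; case: (cw i).
congr (\det _); apply/matrixP => i j; rewrite !mxE.
transitivity ((i == j)%:R - b i * (j == ordS i)%:R - c j * (i == ordS j)%:R
              + x * (i == j)%:R).
  rewrite /b /c [j == i]eq_sym; case: (cw i); case: (cw j); rewrite /= ?mulr0n;
    by case: (i == j); case: (j == ordS i); case: (i == ordS j);
       rewrite /= ?mulr1n ?mulr0n; ring.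
have ordS_eq k : (i == ordS k) = (k == ord_pred i).
  by apply/eqP/eqP => [->|->]; rewrite ?ordSK ?ord_predK.
transitivity (U b i j - c (ord_pred i) * U b (ord_pred i) j).
  rewrite !mxE ord_predK -[ord_pred i == j]eq_sym -ordS_eq [j == i]eq_sym.
  have cb k : c k * b k = x by rewrite /b /c; case: (cw k); rewrite ?mul1r ?mulr1.
  rewrite mulrBr mulrA cb; have [ij|_] := eqVneq i (ordS j); last first.
    by rewrite !mulr0; ring.
  by rewrite ij ordSK; ring.
apply/esym; rewrite (eq_bigr (fun k => (k == i)%:R * U b k j
    - (k == ord_pred i)%:R * (c k * U b k j))) => [|k _]; last first.
  by rewrite !mxE ordS_eq; ring.
by rewrite sumrB !sum_delta.
Qed.

End CycleOrientation.

(** * Posets of type A tilde *)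

Section Covers.
Variables (d : Order.disp_t) (S : finPOrderType d).
Implicit Types s t u : S.

Lemma covers_below s t : (s < t)%O -> exists2 u, covers s u & (u <= t)%O.
Proof.
have [n] := ubnP #|[set u | (s < u)%O && (u < t)%O]|.
elim: n t => // n IH t; rewrite ltnS => leS lt_st.
have [c|] := boolP (covers s t); first by exists t.
rewrite /covers lt_st negb_forall /= => /existsP[u]; rewrite negbK => /andP[su ut].
have [|v sv vu] := IH u _ su; last by exists v => //; exact: le_trans vu (ltW ut).
apply: leq_trans leS; apply: proper_card; apply/properP; split.
  apply/subsetP => v; rewrite !inE => /andP[-> vu] /=.
  exact: lt_trans vu ut.
by exists u; rewrite !inE ?su ?ut // ltxx andbF.
Qed.

(** An element strictly below s has a cover below s; when covers are forced, as
    they are here after a good step, iterating this climbs to s by good steps. *)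
Lemma climb (I : Type) (g : I -> S) (step : I -> I) (good : I -> bool) :
  (forall i u, good i -> covers (g (step i)) u ->
     good (step i) /\ u = g (step (step i))) ->
  forall s i, good i -> (g (step i) <= s)%O ->
  exists2 a, s = g (iter a.+1 step i) & forall b, (b <= a)%N -> good (iter b step i).
Proof.
move=> H s i; have [n] := ubnP #|[set u | (g (step i) < u)%O]|.
elim: n i => // n IH i; rewrite ltnS => len gi.
rewrite le_eqVlt => /predU1P[<-|lt_is].
  by exists 0%N => // b; rewrite leqn0 => /eqP->.
have [u cu us] := covers_below lt_is; have [gi' ui] := H _ _ gi cu.
have [||a sa ga] := IH (step i) _ gi'.
- apply: leq_trans len; apply: proper_card; apply/properP; rewrite -ui.
  have lu : (g (step i) < u)%O by case/andP: cu.
  split; last by exists u; rewrite !inE ?ltxx.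
  by apply/subsetP => v; rewrite !inE; exact: lt_trans.
- by rewrite -ui.
exists a.+1; first by rewrite sa -!iterSr.
by case=> [|b] ba //; rewrite iterSr; exact: ga.
Qed.

End Covers.

Lemma val_iter_ordS n r (i : 'I_n) : iter r (@ordS n) i = ((i + r) %% n)%N :> nat.
Proof.
elim: r => [|r IH]; first by rewrite addn0 modn_small.
by rewrite iterS /= IH -addn1 modnDml addn1 addnS.
Qed.

Lemma iter_ordS_ex n (i j : 'I_n) : exists r, j = iter r (@ordS n) i.
Proof.
exists (j + (n - i))%N; apply/val_inj; rewrite /= val_iter_ordS.
by rewrite addnCA subnKC ?modnDr ?modn_small // ltnW.
Qed.

Section TypeATilde.
Variables (d : Order.disp_t) (S : finPOrderType d) (m : nat).
Variables (f : 'I_m.+1 -> S) (cw : 'I_m.+1 -> bool).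
Hypothesis f_bij : bijective f.
Hypothesis coversE : forall s t, covers s t <->
  exists i, (s, t) = if cw i then (f i, f (ordS i)) else (f (ordS i), f i).
Hypothesis two_sinks : (2 <= #|[set i | cw i && ~~ cw (ordS i)]|)%N.

Local Notation sig := (@ordS m.+1).
Local Notation pi := (@ord_pred m.+1).
Local Notation f_inj := (bij_inj f_bij).

Lemma covers_clockwise i u : cw i -> covers (f (sig i)) u ->
  cw (sig i) /\ u = f (sig (sig i)).
Proof.
move=> ci /coversE[j]; case cj: (cw j) => -[/f_inj e ->]; first by rewrite e.
by move: ci; rewrite (can_inj (@ordSK _) e) cj.
Qed.

Lemma covers_anticlockwise i u : ~~ cw (pi i) -> covers (f (pi i)) u ->
  ~~ cw (pi (pi i)) /\ u = f (pi (pi i)).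
Proof.
move=> ci /coversE[j]; case cj: (cw j) => -[/f_inj e ->].
  by rewrite e cj in ci.
by rewrite e ordSK cj.
Qed.

(** If both neighbours of f i were above f i and below s, then the clockwise and
    the anticlockwise trajectories from f i would cover the cycle and s would be
    its only sink. *)
Lemma no_two_trajectories i s : cw i -> ~~ cw (pi i) ->
  (f (sig i) <= s)%O -> (f (pi i) <= s)%O -> False.
Proof.
move=> ci cpi /(climb covers_clockwise ci)[a sa ha].
move=> /(climb (good := fun j => ~~ cw (pi j)) covers_anticlockwise cpi)[b sb hb].
have sigpi r j : iter r sig (iter r pi j) = j.
  by elim: r j => // r IH j; rewrite iterSr [iter r.+1 pi j]iterS ord_predK IH.
have pisig r j : iter r pi (iter r sig j) = j.
  by elim: r j => // r IH j; rewrite iterSr [iter r.+1 sig j]iterS ordSK IH.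
have e : iter a.+1 sig i = iter b.+1 pi i by apply: f_inj; rewrite -sa.
have period : iter (b.+1 + a.+1) sig i = i by rewrite iterD e sigpi.
have sinkE j : cw j && ~~ cw (sig j) -> j = iter a sig i.
  have [r0 ->] := iter_ordS_ex i j; pose r := (r0 %% (b.+1 + a.+1))%N.
  have rlt : (r < b.+1 + a.+1)%N by rewrite ltn_mod.
  have -> : iter r0 sig i = iter r sig i.
    rewrite (divn_eq r0 (b.+1 + a.+1)) addnC iterD iterM.
    by rewrite (iter_fix _ period).
  have cwE q : (q <= b.+1 + a)%N -> cw (iter q sig i) = (q <= a)%N.
    move=> qle; have [qa|aq] := leqP q a; first exact: ha.
    have -> : iter q sig i = iter (b.+1 + a.+1 - q) pi i.
      rewrite -[X in iter _ pi X]period.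
      have {2}-> : (b.+1 + a.+1 = b.+1 + a.+1 - q + q)%N by lia.
      by rewrite iterD pisig.
    have -> : (b.+1 + a.+1 - q = (b + a.+1 - q).+1)%N by lia.
    by apply/negbTE; rewrite iterS; apply: hb; lia.
  rewrite cwE; last by lia.
  have [ra|] := leqP r a; rewrite //= -iterS.
  have [ra'|ra'] := ltnP r a; first by rewrite cwE ?ra' //; lia.
  by move=> _; have -> : r = a by lia.
move: two_sinks; rewrite leqNgt ltnS => /negP; apply.
rewrite -(cards1 (iter a sig i)); apply: subset_leq_card; apply/subsetP => j.
by rewrite !inE => /sinkE ->.
Qed.

Let R := {poly int}.
Let C : 'M[R]_m.+1 := \matrix_(i, j) (f j <= f i)%O%:R.
Let B : 'M[R]_m.+1 := cycle_euler R cw.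

(** An element f j < f i has exactly one cover below f i; the candidates are the
    two neighbours of f j. *)
Lemma below_cover i j : ((f j <= f i)%O : nat) =
  ((i == j) + (cw j && (f (sig j) <= f i)%O) + (~~ cw (pi j) && (f (pi j) <= f i)%O))%N.
Proof.
have up : cw j -> (f j < f (sig j))%O.
  move=> cj; have /andP[] // : covers (f j) (f (sig j)).
  by apply/coversE; exists j; rewrite cj.
have down : ~~ cw (pi j) -> (f j < f (pi j))%O.
  move=> cj; have /andP[//] : covers (f j) (f (pi j)).
  by apply/coversE; exists (pi j); rewrite ord_predK (negPf cj).
have [->|ij] := eqVneq i j.
  rewrite lexx; case cj: (cw j) => /=.
    rewrite (lt_geF (up cj)); case cpj: (cw (pi j)) => //=.
    by rewrite (lt_geF (down (negbT cpj))).
  by case cpj: (cw (pi j)) => //=; rewrite (lt_geF (down (negbT cpj))).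
rewrite add0n; have [le_ji|/negP nle_ji] := boolP (f j <= f i)%O.
  have lt_ji : (f j < f i)%O by rewrite lt_neqAle le_ji (inj_eq f_inj) eq_sym ij.
  have [u /coversE[k]] := covers_below lt_ji.
  have [cj|cj] := boolP (cw j); have [cpj|cpj] := boolP (cw (pi j)) => /=.
  - case ck: (cw k) => -[/f_inj jk ->]; first by rewrite jk => ->.
    by move: cpj; rewrite jk ordSK ck.
  - case: (boolP (f (sig j) <= f i)%O) => [h1|].
      case: (boolP (f (pi j) <= f i)%O) => // h2.
      by case: (no_two_trajectories cj cpj h1 h2).
    case: (boolP (f (pi j) <= f i)%O) => // /negPf h2 /negPf h1.
    case ck: (cw k) => -[/f_inj jk ->]; first by rewrite -jk h1.
    by move: h2; rewrite jk ordSK => ->.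
  - case ck: (cw k) => -[/f_inj jk ->]; first by rewrite jk ck in cj.
    by move: cpj; rewrite jk ordSK ck.
  - case ck: (cw k) => -[/f_inj jk ->]; first by rewrite jk ck in cj.
    by rewrite jk ordSK => ->.
case cj: (cw j) => /=.
  case: (boolP (f (sig j) <= f i)%O) => [h|_].
    by case: nle_ji; apply: le_trans h; exact: ltW (up cj).
  case cpj: (cw (pi j)) => //=; case: (boolP (f (pi j) <= f i)%O) => // h.
  by case: nle_ji; apply: le_trans h; exact: ltW (down (negbT cpj)).
case cpj: (cw (pi j)) => //=; case: (boolP (f (pi j) <= f i)%O) => // h.
by case: nle_ji; apply: le_trans h; exact: ltW (down (negbT cpj)).
Qed.

Lemma cartan_euler : C *m B = 1%:M.
Proof.
apply/matrixP => i j; rewrite !mxE.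
pose F1 k : R := (f k <= f i)%O%:R.
pose F2 k : R := (cw j)%:R * (f k <= f i)%O%:R.
pose F3 k : R := (~~ cw (pi j))%:R * (f k <= f i)%O%:R.
rewrite (eq_bigr (fun k => (k == j)%:R * F1 k - (k == sig j)%:R * F2 k
                            - (k == pi j)%:R * F3 k)) => [|k _]; last first.
  rewrite !mxE /F1 /F2 /F3.
  have -> : (j == sig k) = (k == pi j).
    by apply/eqP/eqP => ->; rewrite ?ordSK ?ord_predK.
  have [->|_] := eqVneq k (pi j); rewrite -?mulnb ?natrM ?muln0 ?muln1 /= ?mulr1n ?mulr0n.
    by ring.
  by ring.
rewrite !sumrB !sum_delta /F1 /F2 /F3 below_cover !natrD -!natrM !mulnb.
by ring.
Qed.

(** In B + B^T, the diagonal entry 2 is compensated by the entries - 1 at the two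
    neighbours. *)
Lemma euler_const : B^T *m const_mx 1 = - (B *m const_mx 1) :> 'cV_m.+1.
Proof.
apply/colP => i; rewrite !mxE; apply/eqP; rewrite -subr_eq0 opprK -big_split /=.
pose F (k : 'I_m.+1) : R := 1.
rewrite (eq_bigr (fun k => (k == i)%:R * (F k *+ 2) - (k == sig i)%:R * F k
    - (k == pi i)%:R * F k)) => [|k _]; last first.
  rewrite !mxE /F.
  have -> : (i == sig k) = (k == pi i).
    by apply/eqP/eqP => ->; rewrite ?ordSK ?ord_predK.
  rewrite [i == k]eq_sym.
  by case: (cw k); case: (cw i); rewrite /= ?mulr0n; ring.
by rewrite !sumrB !sum_delta /F; apply/eqP; ring.
Qed.

Lemma poset_cox_mxE i j : poset_cox_mx (f i) (f j) = ('X *: C + C^T) i j.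
Proof. by rewrite !mxE. Qed.

(** The congruence by B turns x C + C^T into x B^T + B; its determinant at x = 0
    shows that \det B = 1. *)
Lemma cycle_coxeter : poset_coxeter_poly S =
  (1 - 'X ^+ #|[set i | cw i]|) * (1 - 'X ^+ #|[set i | ~~ cw i]|).
Proof.
rewrite -det_cycle_euler -/B /poset_coxeter_poly (fin_det_ord _ f_bij).
set M := \matrix_(i, j) _; have -> : M = 'X *: C + C^T.
  by apply/matrixP => i j; rewrite mxE poset_cox_mxE.
have detB : \det B = 1.
  have := det_cycle_euler cw (0 : R); rewrite scale0r add0r => ->.
  rewrite !expr0n !cards_eq0.
  have cw_ne (c : bool) : [set i | cw i == c] != set0.
    have /card_gt0P[i] := ltnW two_sinks; rewrite inE => /andP[ci nci].
    by apply/set0Pn; case: c; [exists i | exists (sig i)]; rewrite inE ?ci ?(negPf nci).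
  have -> : [set i | cw i] = [set i | cw i == true].
    by apply/setP => i; rewrite !inE eqb_id.
  have -> : [set i | ~~ cw i] = [set i | cw i == false].
    by apply/setP => i; rewrite !inE eqbF_neg.
  by rewrite !(negPf (cw_ne _)) subr0 mulr1.
have BC : B *m C = 1%:M by apply: mulmx1C; exact: cartan_euler.
have -> : 'X *: B^T + B = B *m ('X *: C + C^T) *m B^T.
  rewrite mulmxDr mulmxDl -scalemxAr BC -scalemxAl mul1mx; congr (_ + _).
  by rewrite -mulmxA -trmx_mul BC trmx1 mulmx1.
by rewrite !det_mulmx det_tr detB mul1r mulr1.
Qed.

Lemma cycle_balanced : balanced (@poset_cox_mx _ S).
Proof.
have [g fK gK] := f_bij.
pose z := B^T *m (const_mx 1 : 'cV_m.+1).
have Mz : ('X *: C + C^T) *m z = const_mx (1 - 'X).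
  rewrite mulmxDl -scalemxAl {1}/z euler_const mulmxN !mulmxA cartan_euler.
  rewrite -trmx_mul mulmx1C ?cartan_euler // trmx1 !mul1mx.
  by apply/colP => i; rewrite !mxE; ring.
have z0 : \sum_i z i 0 = 0.
  pose o : 'rV[R]_m.+1 := const_mx 1.
  have oE (y : 'cV[R]_m.+1) : \sum_i y i 0 = (o *m y) 0 0.
    by rewrite mxE; apply: eq_bigr => i _; rewrite mxE mul1r.
  (* 1^T B^T 1 is its own transpose 1^T B 1, and also its opposite. *)
  have zz : \sum_i z i 0 = - \sum_i z i 0.
    rewrite {1}/z euler_const !oE mulmxN mxE; congr (- _).
    have -> : o *m z = (o *m (B *m const_mx 1))^T.
      by rewrite /z !trmx_mul !trmx_const mulmxA.
    by rewrite [RHS]mxE.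
  move: zz; move: (\sum_i _) => y yN; apply/polyP => k.
  have : y`_k = - y`_k by rewrite {1}yN coefN.
  by move: y`_k => a aN; rewrite coef0; lia.
exists (1 - 'X), (fun s => z (g s) 0); split.
- by rewrite -oppr_eq0 opprB -polyC1 polyXsubC_eq0.
- move=> s; have /colP/(_ (g s)) := Mz; rewrite [RHS]mxE mxE => <-.
  rewrite -{1}[s]gK (reindex _ (onW_bij _ f_bij)) /=.
  by apply: eq_bigr => j _; rewrite fK poset_cox_mxE.
- rewrite -[RHS]z0 (reindex _ (onW_bij _ f_bij)) /=.
  by apply: eq_bigr => j _; rewrite fK.
Qed.

End TypeATilde.

(** * Coxeter polynomials of the posets in the class C *)

Lemma cyclotomic_product1 : cyclotomic_product 1.
Proof. by exists [::]; rewrite ?big_nil. Qed.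

Lemma cyclotomic_productM p q :
  cyclotomic_product p -> cyclotomic_product q -> cyclotomic_product (p * q).
Proof.
move=> [s s0 ->] [t t0 ->]; exists (s ++ t); first by rewrite all_cat s0.
by rewrite big_cat.
Qed.

Lemma cyclotomic_product_Xn_sub1 n : (0 < n)%N -> cyclotomic_product ('X^n - 1).
Proof.
move=> n0; exists (divisors n); last by rewrite prod_Cyclotomic.
by apply/allP => k; rewrite -dvdn_divisors //; apply: dvdn_gt0.
Qed.

Lemma type_A_tilde_props d (S : finPOrderType d) : type_A_tilde S ->
  balanced (@poset_cox_mx _ S) /\ cyclotomic_product (poset_coxeter_poly S).
Proof.
move=> [[|m] [f [cw [f_bij cE [k k2 [sinkE srcE]]]]]].
  by move: k2; rewrite -sinkE eq_card0 // => -[].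
rewrite -sinkE in k2; split; first exact: cycle_balanced f_bij cE k2.
rewrite (cycle_coxeter f_bij cE k2) -mulrNN !opprB.
have /card_gt0P[i] := ltnW k2; rewrite inE => /andP[ci nci].
by apply: cyclotomic_productM; apply: cyclotomic_product_Xn_sub1;
  apply/card_gt0P; [exists i | exists (ordS i)]; rewrite inE.
Qed.

Section InsVert.
Variables (X : eqType) (v : X) (S : eqType).
Implicit Type x : {x : X | x != v} + S.

Definition insert_vert x : X + S :=
  match x with inl a => inl (val a) | inr s => inr s end.

Lemma insert_vertP x : insert_vert x != inl v.
Proof. by case: x => [[a av]|s] //=; rewrite (inj_eq (@inl_inj _ _)). Qed.

Definition to_inserted x : {x : X + S | x != inl v} :=
  Sub (insert_vert x) (insert_vertP x).

Lemma inl_neq (a : X) : (inl a : X + S) != inl v -> a != v.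
Proof. by rewrite (inj_eq (@inl_inj _ _)). Qed.

Lemma to_inserted_bij : bijective to_inserted.
Proof.
pose h (y : {x : X + S | x != inl v}) : {x : X | x != v} + S :=
  (match val y as z return (z != inl v) -> _ with
   | inl a => fun av => inl (Sub a (inl_neq av) : {x | x != v})
   | inr s => fun _ => inr s end) (valP y).
exists h => [[[a av]|s]|[[a|s] av]]; rewrite /h /=.
- by congr inl; apply: val_inj.
- by [].
- by apply: val_inj.
- by apply: val_inj.
Qed.

End InsVert.

Lemma poset_cox_mx_ins d d' (X : finPOrderType d) (v : X) (S : finPOrderType d') x y :
  @poset_cox_mx _ (poset_ins v S) (to_inserted x) (to_inserted y) =
  inserted_mx (@poset_cox_mx _ (poset_del v))
    (fun a => poset_cox_mx (val a) v) (fun a => poset_cox_mx v (val a))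
    (@poset_cox_mx _ S) x y.
Proof. by case: x y => [a|s] [b|t]. Qed.

Lemma poset_cox_mx_iso d d' (S : finPOrderType d) (T : finPOrderType d') (f : S -> T) :
  (forall x y, (f x <= f y)%O = (x <= y)%O) ->
  forall x y, poset_cox_mx (f x) (f y) = poset_cox_mx x y.
Proof. by move=> f_le x y; rewrite /poset_cox_mx /poset_cartan !f_le. Qed.

Lemma class_C_props d (S : finPOrderType d) : class_C S ->
  balanced (@poset_cox_mx _ S) /\ cyclotomic_product (poset_coxeter_poly S).
Proof.
elim=> {d S} [d S S0|d d' d'' X v S T _ [balX cycX] /type_A_tilde_props[balS cycS]].
  split; first exact: balanced_void.
  by rewrite /poset_coxeter_poly fin_det0 //; exact: cyclotomic_product1.
move=> [f f_bij f_le]; have [g fK gK] := f_bij.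
have g_bij : bijective g by exists f.
have g_le x y : (g x <= g y)%O = (x <= y)%O by rewrite -f_le !gK.
have [h hK Kh] := to_inserted_bij v S.
have h_bij : bijective h by exists (@to_inserted _ v S).
have hg_bij : bijective (h \o g) := bij_comp h_bij g_bij.
pose F := inserted_mx (@poset_cox_mx _ (poset_del v))
    (fun a => poset_cox_mx (val a) v) (fun a => poset_cox_mx v (val a))
    (@poset_cox_mx _ S).
have FE (x y : T) : F (h (g x)) (h (g y)) = poset_cox_mx x y.
  rewrite (_ : F _ _ = @poset_cox_mx _ (poset_ins v S)
    (to_inserted (h (g x))) (to_inserted (h (g y)))); last by rewrite poset_cox_mx_ins.
  by rewrite !Kh; exact: poset_cox_mx_iso.
split.
  apply: eq_balanced FE _; apply: (balanced_bij (g := h \o g)) => //.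
  exact: balanced_inserted.
rewrite /poset_coxeter_poly -(eq_fin_det FE).
rewrite (fin_det_bij F hg_bij) det_inserted //.
exact: cyclotomic_productM.
Qed.

(** * Cartan matrices as dimensions of Peirce components *)

Section Peirce.
Variables (K : fieldType) (L : palg K).
Implicit Types i j : palg_idx L.
Local Notation e := (@palg_e K L).

Lemma palg_eK i : e i ** e i = e i.
Proof. by rewrite palg_eM eqxx. Qed.

Definition peirce_proj i j : 'End(L) :=
  (linfun (rmulA (e j)) \o linfun (lmulA (e i)))%VF.

Lemma peirce_projE i j x : peirce_proj i j x = e i ** x ** e j.
Proof. by rewrite comp_lfunE !lfunE. Qed.

Definition peirce i j : {vspace L} := limg (peirce_proj i j).

Lemma peirceP i j x : reflect (e i ** x ** e j = x) (x \in peirce i j).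
Proof.
apply: (iffP idP) => [/memv_imgP[y _ ->]|<-].
  by rewrite peirce_projE !fdmulA palg_eK -!fdmulA palg_eK.
by rewrite -peirce_projE memv_img // memvf.
Qed.

Lemma peirce_l i j x : x \in peirce i j -> e i ** x = x.
Proof. by move/peirceP <-; rewrite !fdmulA palg_eK. Qed.

Lemma peirce_r i j x : x \in peirce i j -> x ** e j = x.
Proof. by move/peirceP <-; rewrite -!fdmulA palg_eK. Qed.

Lemma right_idealP i x : reflect (e i ** x = x) (x \in right_ideal (e i)).
Proof.
apply: (iffP idP) => [/memv_imgP[y _ ->]|<-].
  by rewrite lfunE /= /lmulA fdmulA palg_eK.
by apply/memv_imgP; exists x; rewrite ?memvf // lfunE.
Qed.

(** A homomorphism from e_i L to e_j L is determined by the image of e_i, which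
    can be any element of e_j L e_i. *)
Lemma cartan_peirce i j : cartan i j = \dim (peirce j i).
Proof.
rewrite /cartan; set U := right_ideal (e i); set V := right_ideal (e j).
have UA x a : x \in U -> x ** a \in U.
  by move=> /right_idealP xE; apply/right_idealP; rewrite fdmulA xE.
have Ue : e i \in U by apply/right_idealP; rewrite palg_eK.
pose u : subvs_of U := vsproj U (e i).
have uE : vsval u = e i by rewrite vsprojK.
pose ev (f : 'Hom(subvs_of U, subvs_of V)) : L := vsval (f u).
have ev_lin : linear ev.
  by move=> c f g; rewrite /ev add_lfunE scale_lfunE linearP.
pose evL : {linear _ -> _} := HB.pack ev (GRing.isLinear.Build K _ _ *:%R ev ev_lin).
rewrite -(@limg_dim_eq _ _ _ (linfun evL)); last first.
  apply/eqP; rewrite -subv0; apply/subvP => f /memv_capP[/(module_homP _ UA) fh].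
  rewrite memv_ker lfunE /= => /eqP fu0; rewrite memv0; apply/eqP/lfunP => x.
  rewrite zero_lfunE; apply: val_inj; apply: etrans (fh u x (vsval x) _) _.
    by rewrite uE; apply/esym/right_idealP; exact: subvsP.
  by rewrite -/(ev f) fu0; exact: (linear0 (rmulA _)).
congr (\dim _); apply/vspaceP => z; apply/idP/idP.
  case/memv_imgP => f /(module_homP _ UA) fh ->; rewrite lfunE /= /ev.
  apply/peirceP; rewrite (elimT (right_idealP _ _) (subvsP _)).
  by apply/esym/fh; rewrite uE palg_eK.
move=> zP; pose m (x : subvs_of U) : subvs_of V := vsproj V (z ** vsval x).
have m_lin : linear m.
  by move=> c x y; rewrite /m linearP /= fdmulDr -fdscaleAr linearP.
pose mL : {linear _ -> _} := HB.pack m (GRing.isLinear.Build K _ _ *:%R m m_lin).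
have mE x : vsval (linfun mL x) = z ** vsval x.
  rewrite lfunE /= vsprojK //; apply/right_idealP.
  by rewrite fdmulA (peirce_l zP).
apply/memv_imgP; exists (linfun mL).
  by apply/(module_homP _ UA) => x y a; rewrite !mE => ->; rewrite fdmulA.
by rewrite lfunE /= /ev mE uE (peirce_r zP).
Qed.

End Peirce.

Lemma cartan_corner (K : fieldType) (L : palg K) (v : palg_idx L)
    (i j : palg_idx (corner v)) :
  cartan i j = @cartan K L (val i) (val j).
Proof.
rewrite !cartan_peirce.
have cval_lin : linear (@cval K L _ (corner_unitP v)).
  exact: cval_is_linear.
pose cL : {linear _ -> _} := HB.pack (@cval K L _ (corner_unitP v))
  (GRing.isLinear.Build K _ _ *:%R _ cval_lin).
rewrite -(@limg_dim_eq _ _ _ (linfun cL)); last first.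
  apply/eqP; rewrite -subv0; apply/subvP => x /memv_capP[_].
  rewrite memv_ker lfunE /= memv0 => /eqP x0; apply/eqP/cval_inj.
  by rewrite x0 linear0.
congr (\dim _); apply/vspaceP => z; apply/idP/idP.
  case/memv_imgP => x /(@peirceP _ (corner v)) xE ->; rewrite lfunE /=.
  by apply/peirceP; rewrite -[in RHS]xE !cvalM !cval_corner_e.
move=> zP; have ev (k : palg_idx (corner v)) : palg_e v ** palg_e (val k) = 0 :> L.
  by rewrite palg_eM eq_sym (negPf (valP k)).
have ve (k : palg_idx (corner v)) : palg_e (val k) ** palg_e v = 0 :> L.
  by rewrite palg_eM (negPf (valP k)).
have zc : (fdone - palg_e v) ** z ** (fdone - palg_e v) = z.
  rewrite fdmulBl fdmul1x -{2}(peirce_l zP) fdmulA ev.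
  rewrite [0 ** z](linear0 (rmulA z)) subr0 fdmulBr fdmulx1.
  by rewrite -{2}(peirce_r zP) -fdmulA ve [z ** 0](linear0 (lmulA z)) subr0.
apply/memv_imgP; exists (cproj (corner_unitP v) z); last by rewrite lfunE /= cprojK.
apply/(@peirceP _ (corner v))/cval_inj.
by rewrite !cvalM !cval_corner_e cprojK //; exact/peirceP.
Qed.

(** * Cartan matrices of bound quiver algebras *)

Section FDAlgBasics.
Variables (K : fieldType) (A : fdalgType K).
Implicit Types x y : A.

Lemma fdmul0x x : 0 ** x = 0 :> A. Proof. exact: (linear0 (rmulA x)). Qed.
Lemma fdmulx0 x : x ** 0 = 0 :> A. Proof. exact: (linear0 (lmulA x)). Qed.
Lemma fdmul_suml (I : Type) (r : seq I) (F : I -> A) y :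
  (\sum_(i <- r) F i) ** y = \sum_(i <- r) F i ** y.
Proof. exact: (linear_sum (rmulA y)). Qed.
Lemma fdmul_sumr (I : Type) (r : seq I) (F : I -> A) y :
  y ** (\sum_(i <- r) F i) = \sum_(i <- r) y ** F i.
Proof. exact: (linear_sum (lmulA y)). Qed.

End FDAlgBasics.

Lemma peirce_quot (K : fieldType) (L : palg K) (I : {vspace L}) (HI : two_sided I)
    (i j : palg_idx L) :
  @peirce K (quot_palg HI) i j = (linfun (quotpi HI) @: peirce i j)%VS.
Proof.
apply/vspaceP => z; apply/idP/idP.
  move=> /(@peirceP _ (quot_palg HI)) <-; rewrite -[z]quotreprK.
  apply/memv_imgP; exists (palg_e i ** quotrepr z ** palg_e j).
    by apply/peirceP; rewrite !fdmulA palg_eK -!fdmulA palg_eK.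
  by rewrite lfunE /= [RHS]quotpi_mul quotpi_mul.
case/memv_imgP => x /peirceP xE ->; rewrite lfunE /=.
apply/(@peirceP _ (quot_palg HI)).
by rewrite -[in RHS]xE [RHS]quotpi_mul quotpi_mul.
Qed.

(** Both images are E modulo the kernel of f, which is that of g \o h on E. *)
Lemma dim_img_eq (K : fieldType) (V W V' W' : vectType K) (E : {vspace V})
    (F : {vspace W}) (f : 'Hom(V, V')) (g : 'Hom(W, W')) (h : 'Hom(V, W)) :
  (h @: E = F)%VS -> {in E, forall z, (f z == 0) = (g (h z) == 0)} ->
  \dim (f @: E) = \dim (g @: F).
Proof.
move=> <- fg; rewrite -limg_comp.
apply: (@addnI (\dim (E :&: lker f))); rewrite limg_ker_dim.
rewrite -(limg_ker_dim (g \o h)%VF E); congr (\dim _ + _)%N.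
apply/vspaceP => z; rewrite !memv_cap !memv_ker comp_lfunE.
by have [/fg->|] := boolP (z \in E).
Qed.

Section PathPeirce.
Variables (K : fieldType) (Q : quiver).
Implicit Types (p q : qpath Q) (x : pathalg K Q).

Lemma evert_bpath i p : evert K i ** bpath K p = if qsrc p == i then bpath K p else 0.
Proof.
rewrite [LHS]bpathM; case: eqP => [<-|ip]; last by rewrite qconcat_none // => /esym.
suff /eqP -> : qconcat (qtriv (qsrc p)) p == Some p by [].
by rewrite qconcatE !eqxx.
Qed.

Lemma bpath_evert i p : bpath K p ** evert K i = if qtgt p == i then bpath K p else 0.
Proof.
rewrite [LHS]bpathM; case: eqP => [<-|ip]; last by rewrite qconcat_none.
suff /eqP -> : qconcat p (qtriv (qtgt p)) == Some p by [].
by rewrite qconcatE !eqxx /= cats0.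
Qed.

Lemma peirce_path i j x :
  x \in @peirce K (path_palg K Q) i j <-> parallel_comb i j x.
Proof.
have EE : evert K i ** x ** evert K j =
    \sum_p x p *: (if (qsrc p == i) && (qtgt p == j) then bpath K p else 0).
  rewrite [x in LHS]pathalg_sum fdmul_sumr fdmul_suml; apply: eq_bigr => p _.
  rewrite -fdscaleAr -fdscaleAl evert_bpath; congr (_ *: _).
  by case: eqP; rewrite ?fdmul0x //= bpath_evert.
split=> [/peirceP/= xE p|xp].
  rewrite -xE EE sum_ffunE.
  have [/andP[/eqP-> /eqP->]//|ij] := boolP ((qsrc p == i) && (qtgt p == j)).
  rewrite big1 ?eqxx // => q _; rewrite !ffunE.
  case: ifP => [qij|_]; last by rewrite !ffunE scaler0.
  rewrite bpathE; case: (p =P q) qij => [<-|_ _]; first by rewrite (negPf ij).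
  by rewrite scaler0.
apply/(@peirceP _ (path_palg K Q)); rewrite /= EE [RHS]pathalg_sum; apply: eq_bigr => p _.
have [->|/xp[-> ->]] := eqVneq (x p) 0; first by rewrite !scale0r.
by rewrite !eqxx.
Qed.

Lemma parallel_bpath p : parallel_comb (qsrc p) (qtgt p) (bpath K p).
Proof. by move=> q; rewrite bpathE; case: (q =P p) => [->|]; rewrite ?eqxx. Qed.

Lemma parallel_l i j x : parallel_comb i j x -> evert K i ** x = x.
Proof. by move=> /peirce_path; exact: (@peirce_l _ (path_palg K Q)). Qed.

Lemma parallel_r i j x : parallel_comb i j x -> x ** evert K j = x.
Proof. by move=> /peirce_path; exact: (@peirce_r _ (path_palg K Q)). Qed.

Lemma parallelM i j k x y :
  parallel_comb i j x -> parallel_comb j k y -> parallel_comb i k (x ** y).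
Proof.
move=> xP yP; apply/peirce_path/(@peirceP _ (path_palg K Q)) => /=.
by rewrite fdmulA (parallel_l xP) -fdmulA (parallel_r yP).
Qed.

Lemma parallelB i j x y :
  parallel_comb i j x -> parallel_comb i j y -> parallel_comb i j (x - y).
Proof. by move=> /peirce_path xP /peirce_path yP; apply/peirce_path; rewrite memvB. Qed.

Lemma parallel_sum (I : Type) (r : seq I) (P : pred I) (F : I -> pathalg K Q) i j :
  (forall k, P k -> parallel_comb i j (F k)) ->
  parallel_comb i j (\sum_(k <- r | P k) F k).
Proof.
by move=> PF; apply/peirce_path/memv_suml => k /PF Fk; apply/peirce_path.
Qed.

Lemma parallelZ i j c x : parallel_comb i j x -> parallel_comb i j (c *: x).
Proof. by move=> /peirce_path xP; apply/peirce_path; rewrite memvZ. Qed.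

End PathPeirce.

(** A functor from the path category of Q' to that of Q, given by cv on vertices
    and by ca on arrows; typically it identifies several vertices. *)
Section Collapse.
Variables (K : fieldType) (Q Q' : quiver).
Variables (cv : vert Q' -> vert Q) (ca : arr Q' -> seq (arr Q)).
Hypothesis cwalk : forall i p, walk (@src Q') (@tgt Q') i p ->
  walk (@src Q) (@tgt Q) (cv i) (flatten (map ca p)) /\
  walk_end (@tgt Q) (cv i) (flatten (map ca p)) = cv (walk_end (@tgt Q') i p).
Local Notation KQ := (pathalg K Q).
Local Notation KQ' := (pathalg K Q').

Definition cpath (p : qpath Q') : qpath Q :=
  QPath (proj1 (cwalk (qpathP p)) :
    walk _ _ (cv (qsrc p), flatten (map ca (qarr p))).1 (flatten (map ca (qarr p)))).

Lemma qsrc_cpath p : qsrc (cpath p) = cv (qsrc p). Proof. by []. Qed.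
Lemma qtgt_cpath p : qtgt (cpath p) = cv (qtgt p).
Proof. exact: (proj2 (cwalk (qpathP p))). Qed.
Lemma qarr_cpath p : qarr (cpath p) = flatten (map ca (qarr p)). Proof. by []. Qed.

Definition collapse (x : KQ') : KQ := \sum_p x p *: bpath K (cpath p).

Fact collapse_is_linear : linear collapse.
Proof.
move=> c x y; rewrite /collapse scaler_sumr -big_split; apply: eq_bigr => p _.
by rewrite !ffunE scalerDl scalerA.
Qed.
HB.instance Definition _ :=
  GRing.isLinear.Build K KQ' KQ *:%R collapse collapse_is_linear.

Lemma collapse_bpath p : collapse (bpath K p) = bpath K (cpath p).
Proof.
rewrite /collapse (bigD1 p) //= bpathE eqxx scale1r big1 ?addr0 // => q /negPf qp.
by rewrite bpathE qp scale0r.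
Qed.

Lemma collapseM_bpath p q : qtgt p = qsrc q ->
  collapse (bpath K p ** bpath K q) = bpath K (cpath p) ** bpath K (cpath q).
Proof.
move=> pq; have [r pqr] := qconcat_some pq.
rewrite [X in collapse X]bpathM pqr /= collapse_bpath [RHS]bpathM.
have [_ sr ar _] := qtgt_concat pqr.
suff /eqP -> : qconcat (cpath p) (cpath q) == Some (cpath r) by [].
by rewrite qconcatE qtgt_cpath !qsrc_cpath !qarr_cpath pq sr ar map_cat flatten_cat !eqxx.
Qed.

(** Collapsing is not multiplicative, since distinct vertices may be identified,
    but it is on pairs of composable elements. *)
Lemma collapseM i j k x y : parallel_comb i j x -> parallel_comb j k y ->
  collapse (x ** y) = collapse x ** collapse y.
Proof.
move=> xP yP; rewrite [x]pathalg_sum fdmul_suml !linear_sum fdmul_suml /=.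
apply: eq_bigr => p _; have [->|/xP[_ pj]] := eqVneq (x p) 0.
  by rewrite scale0r fdmul0x linear0 fdmul0x.
rewrite [y]pathalg_sum fdmul_sumr !linear_sum fdmul_sumr /=.
apply: eq_bigr => q _; have [->|/yP[qj _]] := eqVneq (y q) 0.
  by rewrite scale0r fdmulx0 linear0 fdmulx0.
rewrite -fdscaleAl -fdscaleAr !linearZ /= -fdscaleAl -fdscaleAr.
by rewrite collapseM_bpath ?collapse_bpath // pj qj.
Qed.

Lemma collapse_parallel i j x :
  parallel_comb i j x -> parallel_comb (cv i) (cv j) (collapse x).
Proof.
move=> xP; apply: parallel_sum => p _; have [->|/xP[<- <-]] := eqVneq (x p) 0.
  by rewrite scale0r => q; rewrite ffunE eqxx.
by apply: parallelZ; rewrite -qsrc_cpath -qtgt_cpath; exact: parallel_bpath.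
Qed.

Variables (R : KQ -> Prop) (R' : KQ' -> Prop).
Local Notation I := (ideal_gen R).
Local Notation I' := (ideal_gen R').
Hypothesis R'P : forall x, R' x ->
  (exists i j, parallel_comb i j x) /\ collapse x \in I.

(** In a g b, where g is a combination of parallel paths, only the paths of a
    ending at the source of g and the paths of b starting at its target matter,
    and collapsing is multiplicative on them. *)
Lemma collapse_ideal z : z \in I' -> collapse z \in I.
Proof.
move=> zI; suff /subvP/(_ _ zI) : (I' <= linfun collapse @^-1: I)%VS.
  by rewrite -memv_preim lfunE.
apply: vspan_min => _ [a [g [b [/R'P[[i [j gP]] gI] ->]]]].
rewrite -memv_preim lfunE /=.
rewrite [a]pathalg_sum !fdmul_suml linear_sum memv_suml //= => p _.
rewrite -!fdscaleAl linearZ memvZ //=.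
rewrite [b]pathalg_sum fdmul_sumr linear_sum memv_suml //= => q _.
rewrite -fdscaleAr linearZ memvZ //=.
have gE : g = evert K i ** g ** evert K j by rewrite (parallel_l gP) (parallel_r gP).
have [pi|pi] := eqVneq (qtgt p) i; last first.
  by rewrite gE !fdmulA bpath_evert (negPf pi) !fdmul0x linear0 mem0v.
have [qj|qj] := eqVneq (qsrc q) j; last first.
  by rewrite gE -!fdmulA evert_bpath (negPf qj) !fdmulx0 linear0 mem0v.
have pP := @parallel_bpath K Q' p; rewrite pi in pP.
have qP := @parallel_bpath K Q' q; rewrite qj in qP.
have pgP : parallel_comb (qsrc p) j (bpath K p ** g).
  exact: parallelM pP gP.
rewrite (collapseM pgP qP) (collapseM pP gP).
have [Il Ir] := ideal_gen_two_sided (A := KQ) R.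
by apply: Ir; apply: Il.
Qed.

(** The conditions on the lift psi of paths ensure that psi and collapsing induce
    inverse isomorphisms between the components of the two quotient algebras from
    i to j and from cv i to cv j. *)
Lemma cartan_collapse (i j : vert Q') (psi : qpath Q -> KQ') :
  (forall p, qsrc p = cv i -> qtgt p = cv j ->
     exists2 p', psi p = bpath K p' & [/\ qsrc p' = i, qtgt p' = j & cpath p' = p]) ->
  (forall p', qsrc p' = i -> qtgt p' = j -> bpath K p' - psi (cpath p') \in I') ->
  (forall x, x \in I -> parallel_comb (cv i) (cv j) x -> \sum_p x p *: psi p \in I') ->
  @cartan K (bound_quiver_algebra R') j i =
  @cartan K (bound_quiver_algebra R) (cv j) (cv i).
Proof.
move=> psiP psiK psiI; rewrite !cartan_peirce !peirce_quot.
apply: (dim_img_eq (h := linfun collapse)).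
  apply/vspaceP => w; apply/idP/idP.
    case/memv_imgP => z /peirce_path zP ->; rewrite lfunE /=.
    by apply/peirce_path/collapse_parallel.
  move=> /peirce_path wP; rewrite [w]pathalg_sum memv_suml // => p _.
  have [->|/wP[pi pj]] := eqVneq (w p) 0; first by rewrite scale0r mem0v.
  have [p' _ [p'i p'j p'p]] := psiP _ pi pj.
  apply: memvZ; apply/memv_imgP; exists (bpath K p'); last first.
    by rewrite lfunE /= collapse_bpath p'p.
  by apply/peirce_path; rewrite -p'i -p'j; exact: parallel_bpath.
move=> z /peirce_path zP; rewrite !lfunE /= !quotpi_eq0; apply/idP/idP.
  exact: collapse_ideal.
move=> zI; have := psiI _ zI (collapse_parallel zP).
set y := \sum_p _ => yI; rewrite -[z](subrK y) memvD //.
have -> : y = \sum_p z p *: psi (cpath p).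
  rewrite /y; under eq_bigr => q _.
    rewrite /collapse sum_ffunE scaler_suml.
    under eq_bigr => p _ do rewrite !ffunE -scalerA.
    over.
  rewrite exchange_big /=; apply: eq_bigr => p _; rewrite -scaler_sumr; congr (_ *: _).
  rewrite (bigD1 (cpath p)) //= eqxx scale1r big1 ?addr0 // => q /negPf->.
  by rewrite scale0r.
rewrite {1}[z]pathalg_sum -sumrB memv_suml // => p _; rewrite -scalerBr.
have [->|/zP[pi pj]] := eqVneq (z p) 0; first by rewrite scale0r mem0v.
by rewrite memvZ // psiK.
Qed.

End Collapse.

Section BoundQuiver.
Variables (K : fieldType) (Q : quiver) (R : pathalg K Q -> Prop).
Local Notation KQ := (pathalg K Q).
Implicit Types x y : KQ.

Lemma cartan_no_path i j : (forall p : qpath Q, qsrc p = i -> qtgt p = j -> False) ->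
  @cartan K (bound_quiver_algebra R) j i = 0%N.
Proof.
move=> noij; rewrite cartan_peirce peirce_quot.
suff -> : @peirce K (path_palg K Q) i j = 0%VS by rewrite limg0 dimv0.
apply/eqP; rewrite -subv0; apply/subvP => x /peirce_path xP; rewrite memv0.
apply/eqP/ffunP => p; rewrite ffunE; apply/eqP/negPn/negP => /xP[pi pj].
exact: noij pi pj.
Qed.

Hypothesis RP : forall x, R x -> comb_length_ge2 x.

Lemma ideal_length_ge2 x : x \in ideal_gen R -> comb_length_ge2 x.
Proof.
move=> xI p; apply: contraR; rewrite -ltnNge => p2.
pose ev (y : KQ) : K^o := y p.
have ev_lin : linear ev by move=> c y z; rewrite /ev !ffunE.
pose evL : {linear _ -> _} := HB.pack ev (GRing.isLinear.Build K _ _ *:%R ev ev_lin).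
suff /subvP/(_ _ xI) : (ideal_gen R <= lker (linfun evL))%VS.
  by rewrite memv_ker lfunE.
apply: vspan_min => _ [a [g [b [/RP g2 ->]]]]; rewrite memv_ker lfunE /= /ev.
rewrite ffunE big1 // => q _; rewrite big1 // => r /eqP qr.
have [_ _ pE _] := qtgt_concat qr; move: p2; rewrite pE size_cat => p2.
rewrite [X in X * _]ffunE big1 ?mul0r // => s _; rewrite big1 // => t /eqP st.
have [_ _ qE _] := qtgt_concat st; move: p2; rewrite qE size_cat => p2.
have [->|/g2 t2] := eqVneq (g t) 0; first by rewrite mulr0.
by move: p2; lia.
Qed.

(** Without oriented cycles, e_i KQ e_i is the line spanned by e_i, and e_i is not
    in the ideal as it has length 0. *)
Lemma cartan_diag i : @cartan K (bound_quiver_algebra R) i i = 1%N.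
Proof.
rewrite cartan_peirce peirce_quot.
have -> : @peirce K (path_palg K Q) i i = <[evert K i]>%VS.
  apply/eqP; rewrite eqEsubv; apply/andP; split.
    apply/subvP => x /peirce_path xP; rewrite [x]pathalg_sum memv_suml // => p _.
    have [->|/xP[pi pj]] := eqVneq (x p) 0; first by rewrite scale0r mem0v.
    rewrite memvZ //; suff -> : p = qtriv i by rewrite memv_line.
    apply: qpath_inj => //; apply: acyclic (qpathP p) _.
    by rewrite -/(qtgt p) pi pj.
  by rewrite -memvE; apply/peirce_path; exact: (parallel_bpath (p := qtriv i)).
rewrite limg_line dim_vline lfunE /= quotpi_eq0.
case: (boolP (_ \in _)) => // /ideal_length_ge2/(_ (qtriv i)).
by rewrite bpathE eqxx oner_neq0 => /(_ isT).
Qed.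

End BoundQuiver.

(** * Incidence algebras *)

Section Incidence.
Variables (K : fieldType) (d : Order.disp_t) (S : finPOrderType d).
Local Notation H := (hasse_quiver S).

Lemma hasse_path (s t : S) : (s <= t)%O ->
  exists q : qpath H, qsrc q = s /\ qtgt q = t.
Proof.
have [n] := ubnP #|[set u | (s < u)%O]|.
elim: n s => // n IH s; rewrite ltnS => len.
rewrite le_eqVlt => /predU1P[<-|/covers_below[u su ut]].
  by exists (qtriv (s : vert H)).
have lt_su : (s < u)%O by case/andP: su.
have [|q [qs qt]] := IH u _ ut.
  apply: leq_trans len; apply: proper_card; apply/properP.
  split; last by exists u; rewrite !inE ?ltxx.
  by apply/subsetP => v; rewrite !inE; exact: lt_trans.
pose a : arr H := Sub (s, u) su.
have w : walk (@src H) (@tgt H) (s : vert H, a :: qarr q).1 (a :: qarr q).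
  by rewrite /= eqxx -[X in walk _ _ X _]qs; exact: qpathP.
exists (QPath w); split=> //.
by rewrite -qt /qtgt /walk_end /= qs.
Qed.

Lemma qpath_le (q : qpath H) : ((qsrc q : S) <= qtgt q)%O.
Proof. exact: (proj1 (hasse_walk_le (qpathP q))). Qed.

Fact point_acyclic i (p : seq void) :
  walk (of_void unit) (of_void unit) i p ->
  walk_end (of_void unit) i p = i -> p = [::].
Proof. by case: p => [|[]]. Qed.

Definition point_quiver : quiver := Quiver (of_void unit) (of_void unit) point_acyclic.

(** All paths between two elements of S are identified in the incidence algebra,
    which can thus be collapsed to the algebra of a point. *)
Lemma cartan_incidence (s t : S) :
  @cartan K (incidence_algebra S K) s t = poset_cartan s t.
Proof.
rewrite /poset_cartan; case: (boolP (t <= s)%O) => [ts|/negP ts]; last first.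
  by apply: cartan_no_path => p ps pt; apply: ts; rewrite -ps -pt; exact: qpath_le.
pose no_rel (x : pathalg K point_quiver) := False.
have cwalk (i : vert H) (p : seq (arr H)) : walk (@src H) (@tgt H) i p ->
    walk (@src point_quiver) (@tgt _) tt (flatten [seq [::] | _ <- p]) /\
    walk_end (@tgt point_quiver) tt (flatten [seq [::] | _ <- p]) = tt.
  by move=> _; elim: p => // a p [].
apply: etrans (@cartan_diag K point_quiver no_rel _ tt); last by [].
have [q [qs qt]] := hasse_path ts.
have point_path (p : qpath point_quiver) : p = qtriv (tt : vert point_quiver).
  by case: p => [[[] [|[]]] w]; apply: val_inj.
apply: (@cartan_collapse K point_quiver H _ _ cwalk no_rel _ _ t s (fun _ => bpath K q)).
- move=> _ [p1 [p2 [p1s p1t ->]]]; split.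
    exists (qsrc p1), (qtgt p1); apply: parallelB; first exact: parallel_bpath.
    by rewrite p1s p1t; exact: parallel_bpath.
  rewrite linearB /= !collapse_bpath (point_path (cpath cwalk p1)).
  by rewrite (point_path (cpath cwalk p2)) subrr mem0v.
- by move=> p _ _; exists q => //; rewrite (point_path p).
- by move=> p ps pt; apply: mem_ideal_gen; exists p, q; rewrite qs qt.
- move=> x xI _; have -> : x = 0.
    apply/eqP; rewrite -memv0; apply: subvP xI; apply: vspan_min.
    by move=> y [a [g [b [[]]]]].
  by rewrite big1 => [|p _]; [exact: mem0v | rewrite ffunE scale0r].
Qed.

Lemma coxeter_incidence : coxeter_poly (incidence_algebra S K) = poset_coxeter_poly S.
Proof. by apply: eq_fin_det => s t; rewrite !cartan_incidence. Qed.

End Incidence.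

Section Extrema.
Variables (d : Order.disp_t) (S : finPOrderType d).

Lemma min_below (t : S) : exists2 s, is_min s & (s <= t)%O.
Proof.
have [n] := ubnP #|[set u | (u < t)%O]|; elim: n t => // n IH t; rewrite ltnS => len.
have [|] := boolP (is_min t); first by exists t.
rewrite /is_min negb_forall => /existsP[u]; rewrite negbK => ut.
have [|s ms su] := IH u; last by exists s => //; exact: le_trans su (ltW ut).
apply: leq_trans len; apply: proper_card; apply/properP.
split; last by exists u; rewrite !inE ?ltxx.
by apply/subsetP => w; rewrite !inE => /lt_trans; apply.
Qed.

Lemma max_above (s : S) : exists2 t, is_max t & (s <= t)%O.
Proof.
have [n] := ubnP #|[set u | (s < u)%O]|; elim: n s => // n IH s; rewrite ltnS => len.
have [|] := boolP (is_max s); first by exists s.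
rewrite /is_max negb_forall => /existsP[u]; rewrite negbK => su.
have [|t mt ut] := IH u; last by exists t => //; exact: le_trans (ltW su) ut.
apply: leq_trans len; apply: proper_card; apply/properP.
split; last by exists u; rewrite !inE ?ltxx.
by apply/subsetP => w; rewrite !inE; exact: lt_trans.
Qed.

Lemma path_from_min (t : S) :
  exists q : qpath (hasse_quiver S), is_min (qsrc q : S) /\ qtgt q = t.
Proof.
by have [s ms /hasse_path[q [qs qt]]] := min_below t; exists q; rewrite qs.
Qed.

Lemma path_to_max (s : S) :
  exists q : qpath (hasse_quiver S), qsrc q = s /\ is_max (qtgt q : S).
Proof.
by have [t mt /hasse_path[q [qs qt]]] := max_above s; exists q; rewrite qt.
Qed.

Lemma minmax_path_exists (s : S) :
  exists q : qpath (hasse_quiver S), minmax_path q.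
Proof.
have [p [mp _]] := path_from_min s; have [q [qs mq]] := path_to_max (qsrc p).
by exists q; split; rewrite ?qs.
Qed.

End Extrema.

(** * Insertion into an algebra *)

Section Walks.
Variable Q : quiver.
Implicit Types (i v : vert Q) (a : arr Q) (l : seq (arr Q)).
Local Notation qwalk := (walk (@src Q) (@tgt Q)).
Local Notation qend := (walk_end (@tgt Q)).

Lemma walk_end_cons i a l : qend i (a :: l) = qend (tgt a) l.
Proof. by []. Qed.

Lemma walk_no_return v l a : qwalk v l -> a \in l -> tgt a != v.
Proof.
move=> w al; apply/eqP => av; have /= /andP[/negP[]] := walk_uniq w.
by rewrite -[X in X \in _]av map_f.
Qed.

Lemma walk_no_exit i l a : qwalk i l -> a \in l -> src a != qend i l.
Proof.
move=> w al; case/splitPr: al w => l1 l2; rewrite walk_cat walk_end_cat => /andP[_ w].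
apply/eqP => e; have /acyclic : qwalk (src a) (a :: l2).
  by move: w => /= /andP[_ ->]; rewrite eqxx.
by rewrite [in X in X -> _]walk_end_cons => /(_ (esym e)).
Qed.

Lemma walk_avoid v i l : i != v -> qwalk i l -> {in l, forall a, tgt a != v} ->
  {in l, forall a, src a != v}.
Proof.
elim: l i => // a l IH i iv /= /andP[/eqP ai w] lv b.
rewrite inE => /predU1P[->|bl]; first by rewrite ai.
have av : tgt a != v by apply: lv; rewrite mem_head.
by apply: (IH _ av w) bl => c cl; apply: lv; rewrite inE cl orbT.
Qed.

End Walks.

Section AlgInsertion.
Variables (K : fieldType) (L : triangular_algebra K) (v : vert L).
Variables (d : Order.disp_t) (S : finPOrderType d).
Local Notation H := (hasse_quiver S).
Local Notation Q' := (ins_quiver v S).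
Local Notation KQ := (pathalg K L).
Local Notation KQ' := (pathalg K (ins_quiver v S)).
Local Notation iv := (@ivert K L v d S).
Local Notation ia := (@iarr K L v d S).
Local Notation vS := (vert L + S)%type.

Let cvert (x : vert Q') : vert L := collapse_vert v (val x).
Let carr (a : arr Q') : seq (arr L) := collapse_arr (val a).
Let cwalk : forall i p, walk (@src Q') (@tgt Q') i p ->
  walk (@src L) (@tgt L) (cvert i) (flatten (map carr p)) /\
  walk_end (@tgt L) (cvert i) (flatten (map carr p)) = cvert (walk_end (@tgt Q') i p).
Proof. by move=> i p /collapse_walk. Qed.
Local Notation cp := (@cpath L Q' cvert carr cwalk).

Lemma ivertE (x : vert Q') : iv (val x) = evert K x.
Proof. by rewrite /ivert valK. Qed.

Lemma iarrE (a : arr Q') : ia (val a) = earr K a.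
Proof. by rewrite /iarr valK. Qed.

(** Records that a product of vertices and arrows is a single path, and what this
    path collapses to, so that such products can be handled without constructing
    the path. *)
Definition is_path (x y : vS) (l : seq (arr L)) (z : KQ') : Prop :=
  exists2 p : qpath Q', z = bpath K p &
    [/\ val (qsrc p) = x, val (qtgt p) = y & qarr (cp p) = l].

Lemma is_path_vert x : ins_vert_ok v x -> is_path x x [::] (iv x).
Proof.
move=> xv; exists (qtriv (Sub x xv : vert Q')); last by [].
by rewrite -/(evert K _) -ivertE.
Qed.

Lemma is_path_arr a : ins_arr_ok v a ->
  is_path (raw_src a) (raw_tgt a) (collapse_arr a) (ia a).
Proof.
move=> av; exists (qsingle (Sub a av : arr Q')); first by rewrite -/(earr K _) -iarrE.
by split; rewrite ?qarr_cpath //= cats0.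
Qed.

Lemma is_path_mul x y z k l a b :
  is_path x y k a -> is_path y z l b -> is_path x z (k ++ l) (a ** b).
Proof.
move=> [p -> [px py pk]] [q -> [qy qz ql]].
have pq : qtgt p = qsrc q by apply: val_inj; rewrite py qy.
have [r pqr] := qconcat_some pq; have [_ sr ar tr] := qtgt_concat pqr.
exists r; first by rewrite [LHS]bpathM pqr.
split; rewrite ?sr ?tr //.
by rewrite -pk -ql !qarr_cpath ar map_cat flatten_cat.
Qed.

Lemma is_path_l x y l z : is_path x y l z -> iv x ** z = z.
Proof. by move=> [p -> [<- _ _]]; rewrite ivertE evert_bpath eqxx. Qed.

Lemma is_path_r x y l z : is_path x y l z -> z ** iv y = z.
Proof. by move=> [p -> [_ <- _]]; rewrite ivertE bpath_evert eqxx. Qed.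

Local Notation icat F l := (\big[fdmul/(fdone : KQ')]_(a <- l) F a).

(** The paths (p, s), (s, p) and those obtained from p by inserting a path of S
    are all products of factors F a along p; loc i is the place where the product
    stands when p is at i, which is an element of S when i = v. *)
Lemma is_path_prod (loc : vert L -> vS) (F : arr L -> KQ') i l :
  (forall j, ins_vert_ok v (loc j)) ->
  walk (@src L) (@tgt L) i l ->
  {in l, forall a, is_path (loc (src a)) (loc (tgt a)) [:: a] (F a)} ->
  is_path (loc i) (loc (walk_end (@tgt L) i l)) l (iv (loc i) ** icat F l).
Proof.
move=> locv; elim: l i => [|a l IH] i /=.
  by rewrite big_nil fdmulx1 => _ _; exact: is_path_vert.
move=> /andP[/eqP <- w] FP; rewrite big_cons fdmulA.
have aP : is_path (loc (src a)) (loc (tgt a)) [:: a] (F a) by apply: FP; rewrite mem_head.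
rewrite (is_path_l aP) -(is_path_r aP) -fdmulA.
apply: (is_path_mul aP); apply: IH w _ => b bl.
by apply: FP; rewrite inE bl orbT.
Qed.

Lemma is_path_inner i (l : seq (arr H)) : walk (@src H) (@tgt H) i l ->
  is_path (inr i) (inr (walk_end (@tgt H) i l)) [::]
    (iv (inr i) ** icat (fun c => ia (Inner L c)) l).
Proof.
elim: l i => [|c l IH] i /=; first by rewrite big_nil fdmulx1 => _; exact: is_path_vert.
move=> /andP[/eqP <- /IH w]; rewrite big_cons fdmulA.
have cP := @is_path_arr (Inner L c) isT.
rewrite (is_path_l cP) -(is_path_r cP) -fdmulA.
exact: (is_path_mul cP).
Qed.

Lemma is_path_ipath (q : qpath H) :
  is_path (inr (qsrc q)) (inr (qtgt q)) [::] (ipath v q).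
Proof. exact: is_path_inner (qpathP q). Qed.

Let loc (s : S) (i : vert L) : vS := if i == v then inr s else inl i.

Let locv s : loc s v = inr s. Proof. by rewrite /loc eqxx. Qed.
Let locN s i : i != v -> loc s i = inl i. Proof. by rewrite /loc => /negPf->. Qed.
Let loc_ok s i : ins_vert_ok v (loc s i).
Proof. by rewrite /loc; case: eqVneq. Qed.

Lemma is_path_outer a : src a != v -> tgt a != v ->
  is_path (inl (src a)) (inl (tgt a)) [:: a] (ia (Outer S a)).
Proof. by move=> sv tv; apply: is_path_arr; rewrite /= sv. Qed.

Lemma is_path_Into a s : tgt a = v -> is_min s ->
  is_path (inl (src a)) (inr s) [:: a] (ia (Into a s)).
Proof. by move=> av ms; apply: is_path_arr; rewrite /= av eqxx. Qed.

Lemma is_path_From a s : src a = v -> is_max s ->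
  is_path (inr s) (inl (tgt a)) [:: a] (ia (From s a)).
Proof. by move=> av ms; apply: is_path_arr; rewrite /= av eqxx. Qed.

Lemma path_intoP p s : qsrc p != v -> qtgt p = v -> is_min s ->
  is_path (inl (qsrc p)) (inr s) (qarr p) (path_into v p s).
Proof.
move=> pv vp ms; rewrite -[X in is_path _ X](locv s) -{1}vp -(locN s pv) /path_into.
rewrite -(locN s pv); apply: is_path_prod (qpathP p) _ => // a ap.
have av : src a != v by rewrite -vp; exact: walk_no_exit (qpathP p) ap.
rewrite (locN s av) /loc; case: eqP => [e|/eqP e]; first exact: is_path_Into.
exact: is_path_outer.
Qed.

Lemma path_fromP p s : qsrc p = v -> qtgt p != v -> is_max s ->
  is_path (inr s) (inl (qtgt p)) (qarr p) (path_from v s p).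
Proof.
have locp : qsrc p = v -> inr s = loc s (qsrc p) by move=> ->; rewrite locv.
move=> pv vp ms; rewrite /path_from (locp pv) -(locN s vp).
apply: is_path_prod (qpathP p) _ => // a ap.
have av : tgt a != v by rewrite -pv; exact: walk_no_return (qpathP p) ap.
rewrite (locN s av) /loc; case: eqP => [e|/eqP e]; first exact: is_path_From.
exact: is_path_outer.
Qed.

Lemma path_throughP q p : qsrc p != v -> qtgt p != v -> minmax_path q ->
  is_path (inl (qsrc p)) (inl (qtgt p)) (qarr p) (path_through v q p).
Proof.
move=> pv vp [mq qm].
rewrite -(locN (qtgt q) pv) -(locN (qtgt q) vp) /path_through -(locN (qtgt q) pv).
apply: is_path_prod (qpathP p) _ => // a ap.
have [av|av] := eqVneq (tgt a) v.
  have sv : src a != v by rewrite -av no_loop.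
  rewrite av locv (locN _ sv) -[[:: a]]/([:: a] ++ [::]).
  exact: is_path_mul (is_path_Into av mq) (is_path_ipath q).
rewrite (locN _ av) /loc; case: eqP => [e|/eqP e]; first exact: is_path_From.
exact: is_path_outer.
Qed.

Lemma is_path_parallel (i j : vert Q') l z :
  is_path (val i) (val j) l z -> parallel_comb i j z.
Proof.
move=> [p -> [pi pj _]]; rewrite -(val_inj pi) -(val_inj pj).
exact: parallel_bpath.
Qed.

Lemma collapse_is_path x y (p : qpath L) z : qsrc p = collapse_vert v x ->
  is_path x y (qarr p) z -> collapse cwalk z = bpath K p.
Proof.
move=> px [p' -> [xp' _ pp']]; rewrite collapse_bpath; congr (bpath K _).
by apply: qpath_inj => //; rewrite qsrc_cpath px /cvert xp'.
Qed.

Local Notation I := (tri_ideal L).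
Local Notation I' := (ideal_gen (@ins_rel K L v d S)).

(** A relation obtained by lifting an element w of I term by term collapses to
    w. *)
Lemma collapse_comb x y (w : KQ) (F : qpath L -> KQ') :
  ins_vert_ok v x -> ins_vert_ok v y -> w \in I ->
  (forall p, w p != 0 -> qsrc p = collapse_vert v x /\ is_path x y (qarr p) (F p)) ->
  (exists i j : vert Q', parallel_comb i j (\sum_p w p *: F p)) /\
  collapse cwalk (\sum_p w p *: F p) \in I.
Proof.
move=> xv yv wI FP; split.
  exists (Sub x xv), (Sub y yv); apply: parallel_sum => p _.
  have [->|/FP[_ pP]] := eqVneq (w p) 0; last first.
    exact/parallelZ/(@is_path_parallel (Sub x xv) (Sub y yv) _ _ pP).
  by rewrite scale0r => q; rewrite ffunE eqxx.
rewrite linear_sum /=; suff -> : \sum_p collapse cwalk (w p *: F p) = w by [].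
rewrite [RHS]pathalg_sum; apply: eq_bigr => p _; rewrite linearZ /=.
have [->|/FP[px pP]] := eqVneq (w p) 0; first by rewrite !scale0r.
by congr (_ *: _); exact: collapse_is_path px pP.
Qed.

(** Both terms collapse to the same path, with arrows l. *)
Lemma collapse_diff x y l (z z' : KQ') : is_path x y l z -> is_path x y l z' ->
  (exists i j : vert Q', parallel_comb i j (z - z')) /\
  collapse cwalk (z - z') \in I.
Proof.
move=> zP z'P; split.
  have [p _ [px py _]] := zP; exists (qsrc p), (qtgt p).
  by apply: parallelB; apply: (@is_path_parallel _ _ l); rewrite px py.
move: zP z'P => [p -> [px py pl]] [p' -> [p'x p'y p'l]].
rewrite linearB /= !collapse_bpath (_ : cp p = cp p') ?subrr ?mem0v //.
by apply: qpath_inj; rewrite ?pl ?p'l // !qsrc_cpath /cvert px p'x.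
Qed.

(** The only path from v to v has length 0. *)
Lemma ideal_loop x : x \in I -> parallel_comb v v x -> x = 0.
Proof.
move=> xI xP; apply/ffunP => p; rewrite ffunE; apply/eqP/negPn/negP => xp.
have R2 y : @tri_rel K L y -> comb_length_ge2 y by case/tri_relP.
have := ideal_length_ge2 R2 xI xp; have [pv vp] := xP p xp.
by rewrite (acyclic (qpathP p)) // -/(qtgt p) pv.
Qed.

Lemma ins_relP x : ins_rel x ->
  (exists i j : vert Q', parallel_comb i j x) /\ collapse cwalk x \in I.
Proof.
case=> {x} [x i s xI xP ms|x j s xI xP ms|q1 q2 q12 q12'|a q1 q2 av m1 m2 q12
  |b q1 q2 bv m1 m2 q12|a b q1 q2 av bv [m1 m1'] [m2 m2']|x i j q xI xP iv jv mq].
- have [iv|iv] := eqVneq i v.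
    rewrite iv in xP; apply: (@collapse_comb (inr s) (inr s)) => // p.
    by rewrite (ideal_loop xI xP) ffunE eqxx.
  apply: (@collapse_comb (inl i) (inr s)) => //.
  move=> p /xP[pi pv]; split; first by [].
  by rewrite -pi; apply: path_intoP; rewrite // pi.
- have [jv|jv] := eqVneq j v.
    rewrite jv in xP; apply: (@collapse_comb (inr s) (inr s)) => // p.
    by rewrite (ideal_loop xI xP) ffunE eqxx.
  apply: (@collapse_comb (inr s) (inl j)) => //.
  move=> p /xP[pv pj]; split; first by [].
  by rewrite -pj; apply: path_fromP; rewrite // pj.
- have := is_path_ipath q2; rewrite -q12 -q12'.
  exact: collapse_diff (is_path_ipath q1).
- have P2 := is_path_mul (is_path_Into av m2) (is_path_ipath q2).
  rewrite -q12 in P2; apply: collapse_diff P2.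
  exact: is_path_mul (is_path_Into av m1) (is_path_ipath q1).
- have P2 := is_path_mul (is_path_ipath q2) (is_path_From bv m2).
  rewrite -q12 in P2; apply: collapse_diff P2.
  exact: is_path_mul (is_path_ipath q1) (is_path_From bv m1).
- have P (q : qpath H) : is_min (qsrc q : S) -> is_max (qtgt q : S) ->
    is_path (inl (src a)) (inl (tgt b)) [:: a; b]
      (ia (Into a (qsrc q)) ** ipath v q ** ia (From (qtgt q) b)).
    move=> mq qm; apply: (is_path_mul (k := [:: a]) _ (is_path_From bv qm)).
    exact: is_path_mul (is_path_Into av mq) (is_path_ipath q).
  exact: collapse_diff (P _ m1 m1') (P _ m2 m2').
- apply: (@collapse_comb (inl i) (inl j)) => //.
  move=> p /xP[pi pj]; split; first by [].
  by rewrite -pi -pj; apply: path_throughP; rewrite ?pi ?pj.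
Qed.

Local Notation HI' := (ideal_gen_two_sided (@ins_rel K L v d S)).
Let cong (x y : KQ') : Prop := quotpi HI' x = quotpi HI' y.

Let congM x x' y y' : cong x x' -> cong y y' -> cong (x ** y) (x' ** y').
Proof. by rewrite /cong !quotpi_mul => -> ->. Qed.

Let cong_rel x y : ins_rel (x - y) -> cong x y.
Proof. by move=> xy; apply/eqP; rewrite quotpi_eq; exact: mem_ideal_gen. Qed.

(** The class of a walk, as the product of its arrows; this form allows one to
    peel off the first arrow. *)
Let wpath (i : vert Q') (l : seq (arr Q')) : KQ' :=
  iv (val i) ** icat (fun a => ia (val a)) l.

Let wpath_cons a l : wpath (src a) (a :: l) = ia (val a) ** wpath (tgt a) l.
Proof.
have aP := is_path_arr (valP a).
rewrite /wpath big_cons !fdmulA; congr (_ ** _).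
by rewrite [LHS](is_path_l aP) [RHS](is_path_r aP).
Qed.

Let bpath_wpath (p : qpath Q') : bpath K p = wpath (qsrc p) (qarr p).
Proof.
case: p => [[i l] w]; rewrite /qsrc /qarr /=; elim: l i w => [|a l IH] i w.
  rewrite /wpath big_nil fdmulx1 ivertE; congr (bpath K _); exact: qpath_inj.
have /= /andP[/eqP ai wl] := w; rewrite -{2}ai wpath_cons -(IH _ wl) iarrE.
pose pl := QPath (qpath_val := (tgt a, l)) wl; rewrite [RHS]bpathM.
suff /eqP -> : qconcat (qsingle a) pl == Some (QPath w) by [].
by rewrite qconcatE /qtgt /qsrc /qarr /walk_end /= ai !eqxx.
Qed.

Let cong_ipath (q1 q2 : qpath H) : qsrc q1 = qsrc q2 -> qtgt q1 = qtgt q2 ->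
  cong (ipath v q1) (ipath v q2).
Proof. by move=> s12 t12; apply: cong_rel; exact: Ins_2a. Qed.

Lemma ipath_cons (c : arr H) (q : qpath H) : qsrc q = tgt c ->
  exists q', [/\ qsrc q' = src c, qtgt q' = qtgt q &
                 ia (Inner L c) ** ipath v q = ipath v q'].
Proof.
move=> qc; have w : walk (@src H) (@tgt H) (src c, c :: qarr q).1 (c :: qarr q).
  by rewrite /= eqxx; have := qpathP q; rewrite qc.
exists (QPath w); split=> //; first by rewrite /qtgt qc.
have cP := @is_path_arr (Inner L c) isT.
rewrite /ipath big_cons !fdmulA; congr (_ ** _).
by rewrite [RHS](is_path_l cP) qc [LHS](is_path_r cP).
Qed.

(** The factors of path_through, path_from and path_into at an arrow, and the
    sequence of arrows of the collapse of a walk. *)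
Let thr (q : qpath H) (a : arr L) : KQ' :=
  if tgt a == v then ia (Into a (qsrc q)) ** ipath v q
  else if src a == v then ia (From (qtgt q) a) else ia (Outer S a).
Let fr (s : S) (a : arr L) : KQ' :=
  if src a == v then ia (From s a) else ia (Outer S a).
Let into (s : S) (a : arr L) : KQ' :=
  if tgt a == v then ia (Into a s) else ia (Outer S a).
Let cl (l : seq (arr Q')) : seq (arr L) := flatten (map carr l).

(** Having left v by some arrow, a walk only follows arrows avoiding v. *)
Let leave_v m : walk (@src L) (@tgt L) v m -> walk_end (@tgt L) v m != v ->
  exists b r, let R := icat (fun a => ia (Outer S a)) r in
  [/\ m = b :: r, src b = v,
      forall s, icat (fr s) m = ia (From s b) ** R,
      forall q, icat (thr q) m = ia (From (qtgt q) b) ** R &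
      forall q, icat (thr q) r = R].
Proof.
case: m => [|b r] w; first by rewrite eqxx.
have /= /andP[/eqP bv wr] := w => _.
have tv : {in b :: r, forall a, tgt a != v} by move=> a; exact: walk_no_return w.
have bN : tgt b != v by apply: tv; rewrite mem_head.
have rtv : {in r, forall a, tgt a != v} by move=> a ar; apply: tv; rewrite inE ar orbT.
have rsv := walk_avoid bN wr rtv.
have thrE q : icat (thr q) r = icat (fun a => ia (Outer S a)) r.
  by apply: eq_big_seq => a ar; rewrite /thr (negPf (rtv a ar)) (negPf (rsv a ar)).
exists b, r; split=> // [s|q]; rewrite big_cons.
  rewrite {1}/fr bv eqxx; congr (_ ** _); apply: eq_big_seq => a ar.
  by rewrite /fr (negPf (rsv a ar)).
by rewrite thrE /thr (negPf bN) bv eqxx.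
Qed.

Section Congruence.
Variables (q0 : qpath H) (qm : S -> qpath H).
Hypothesis q0P : minmax_path q0.
Hypothesis qmP : forall s, qsrc (qm s) = s /\ is_max (qtgt (qm s) : S).

(** The normal form of a path ending outside S: when it starts in S, the path qm s
    leads to a maximal element; when it goes through S, it does so along q0. *)
Let norm_out (x : vS) (m : seq (arr L)) : KQ' := match x with
  | inl i => iv (inl i) ** icat (thr q0) m
  | inr s => ipath v (qm s) ** (iv (inr (qtgt (qm s))) ** icat (fr (qtgt (qm s))) m)
  end.

Let norm_out_leave s b r : is_max s -> src b = v ->
  iv (inr s) ** (ia (From s b) ** r) = ia (From s b) ** r.
Proof. by move=> ms bv; rewrite fdmulA (is_path_l (is_path_From bv ms)). Qed.

(** By induction on the walk. The relations are needed when the first arrow enters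
    S (Ins_2d), stays in S or leaves S (Ins_2c): the normal form of the remaining walk
    then starts with a path of S followed by an arrow starting at v. *)
Lemma cong_out b i l : b != v -> walk (@src Q') (@tgt Q') i l ->
  val (walk_end (@tgt Q') i l) = inl b -> cong (wpath i l) (norm_out (val i) (cl l)).
Proof.
rewrite /norm_out => bv; elim: l i => [|a l IH] i.
  by move=> _ ib; rewrite /wpath /cl {}ib !big_nil.
case/andP => /eqP <- w; rewrite walk_end_cons => le.
have IHl := IH _ w le; rewrite wpath_cons.
have [wcl ecl] := cwalk w; rewrite {2}/cvert le /= in ecl.
move: IHl wcl ecl; rewrite /cvert /cl /= {1}/carr.
case: a w le => [[g|c|g s|s g] ok] w le /= IHl wcl ecl.
- have [sv tv] := andP ok.
  rewrite big_cons {1}/thr (negPf sv) (negPf tv) fdmulA.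
  have gP := is_path_outer sv tv; rewrite [X in cong _ (X ** _)](is_path_l gP).
  rewrite -[X in cong _ (X ** _)](is_path_r gP) -fdmulA.
  exact: congM IHl.
- have [_ mt] := qmP (tgt c); have [sc ms] := qmP (src c).
  have [|b' [r [_ b'v frE _ _]]] := leave_v wcl; first by rewrite ecl.
  move: IHl; rewrite !frE !norm_out_leave // => IHl.
  have [q' [q's q't q'E]] := ipath_cons (proj1 (qmP (tgt c))).
  have {}q'E : ia (Inner L c) ** ipath v (qm (hasse_tgt c)) = ipath v q' := q'E.
  apply: etrans (congM (erefl _ : cong (ia (Inner L c)) _) IHl) _.
  rewrite (fdmulA (ia (Inner L c)) (ipath v _)) q'E !(fdmulA (ipath v _) (ia _)).
  rewrite -[X in ia (From X _)]q't; apply: congM => //.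
  by apply/cong_rel/Ins_2c; rewrite ?q't ?q's.
- have [/eqP gv ms] := andP ok; have [sc mm] := qmP s.
  have [|b' [r [_ b'v frE thrE _]]] := leave_v wcl; first by rewrite ecl.
  move: IHl; rewrite frE norm_out_leave // => IHl.
  have [mq0 q0m] := q0P.
  rewrite big_cons {1}/thr gv eqxx thrE (fdmulA (iv _)).
  rewrite (is_path_l (is_path_mul (is_path_Into gv mq0) (is_path_ipath q0))).
  apply: etrans (congM (erefl _ : cong (ia (Into g s)) _) IHl) _.
  rewrite (fdmulA (ia (Into g s)) (ipath v _)).
  rewrite (fdmulA (ia (Into g s) ** ipath v _) (ia _)).
  rewrite (fdmulA (ia (Into g (qsrc q0)) ** ipath v _) (ia _)).
  apply: congM => //; apply: cong_rel; rewrite -{1}sc.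
  by apply: Ins_2d => //; split; rewrite ?sc.
- have [/eqP gv ms] := andP ok; have [sc mm] := qmP s.
  have gm : walk (@src L) (@tgt L) v (g :: flatten (map carr l)) by rewrite /= gv eqxx.
  have [|b' [r [[<- <-] _ frE _ thrE]]] := leave_v gm; first by rewrite walk_end_cons ecl.
  apply: etrans (congM (erefl _ : cong (ia (From s g)) _) IHl) _.
  rewrite frE thrE norm_out_leave // (fdmulA (ia (From s g))).
  have gP := is_path_From gv ms; rewrite (is_path_r gP) -{1}(is_path_l gP).
  have -> : iv (inr s) = ipath v (qtriv (s : vert H)) by rewrite /ipath big_nil fdmulx1.
  rewrite (fdmulA (ipath v (qm s))); apply: congM => //.
  by apply: cong_rel; exact: (Ins_2c (q1 := qtriv (s : vert H))).
Qed.

End Congruence.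

(** A walk between elements of S cannot leave S, since its collapse would be an
    oriented cycle through v. *)
Lemma wpath_inner t s i l : walk (@src Q') (@tgt Q') i l ->
  val (walk_end (@tgt Q') i l) = inr t -> val i = inr s ->
  cl l = [::] /\ exists q : qpath H, [/\ qsrc q = s, qtgt q = t & wpath i l = ipath v q].
Proof.
move=> w le iE; have [wcl ecl] := cwalk w.
have cl0 : cl l = [::].
  by apply: acyclic wcl _; rewrite ecl /cvert le iE.
split=> //; move: cl0 {wcl ecl} w le s iE; elim: l i => [|a l IH] i.
  move=> _ _ ei s iE; exists (qtriv (s : vert H)); split=> //.
    by move: ei; rewrite [val _]iE => -[].
  by rewrite /wpath iE /ipath !big_nil.
move=> cl0 /andP[/eqP ai w]; rewrite walk_end_cons => le s iE.
rewrite -ai wpath_cons; move: cl0 iE; rewrite /cl /= -{}ai.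
case: a w le => [[g|c|g s'|s' g] ok] w le //= cl0 [<-].
have [q [qs qt qE]] := IH _ cl0 w le _ erefl.
have [q' [q's q't q'E]] := ipath_cons qs.
by exists q'; rewrite q's q't qt qE -q'E.
Qed.

(** By induction on the walk; when its first arrow enters S, the remaining walk
    stays in S and Ins_2b applies. *)
Lemma cong_in (qt : qpath H) b i l : is_min (qsrc qt : S) ->
  walk (@src Q') (@tgt Q') i l ->
  val (walk_end (@tgt Q') i l) = inr (qtgt qt) -> val i = inl b ->
  cong (wpath i l) (iv (inl b) ** icat (into (qsrc qt)) (cl l) ** ipath v qt).
Proof.
move=> mqt; elim: l i b => [|a l IH] i b; first by move=> _ /[swap] ->.
case/andP => /eqP <- w; rewrite walk_end_cons => le.
rewrite wpath_cons /cl /=.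
case: a w le => [[g|c|g s|s g] ok] w le //= [<-]; rewrite big_cons.
  have [sv tv] := andP ok.
  rewrite /into (negPf tv) -/(into _) fdmulA.
  have gP := is_path_outer sv tv.
  rewrite (is_path_l gP) -[X in cong _ (X ** _ ** _)](is_path_r gP).
  rewrite -[ia _ ** iv _ ** _]fdmulA -[_ ** _ ** ipath v qt]fdmulA.
  by apply: congM => //; exact: IH w le _.
have [/eqP gv ms] := andP ok.
have [cl0 [q [qs q_t qE]]] := wpath_inner w le erefl.
rewrite qE [flatten _]cl0 big_nil fdmulx1 /into gv eqxx.
rewrite (is_path_l (is_path_Into gv mqt)) -qs.
by apply/cong_rel/Ins_2b; rewrite ?qs.
Qed.

(** Each case exhibits a lift of paths, and the relation showing that it maps the
    ideal of L into that of the insertion: Ins_3 outside S, Ins_1b from S, Ins_1a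
    to S. Between elements of S there is nothing to lift but e_v, as S is collapsed to
    a point. *)
Lemma cartan_insertion (s0 : S) (x y : vert Q') :
  @cartan K (bound_quiver_algebra (@ins_rel K L v d S)) x y =
  match val x, val y with
  | inl a, inl b => @cartan K (tri_alg L) a b
  | inl a, inr _ => @cartan K (tri_alg L) a v
  | inr _, inl b => @cartan K (tri_alg L) v b
  | inr s, inr t => poset_cartan s t
  end.
Proof.
have R2 z : @tri_rel K L z -> comb_length_ge2 z by case/tri_relP.
have [Il Ir] := ideal_gen_two_sided (@ins_rel K L v d S).
have congP z z' : cong z z' -> z - z' \in I' by move=> /eqP; rewrite quotpi_eq.
have [q0 q0P] := minmax_path_exists s0.
have [qm qmP] := fin_all_exists (@path_to_max _ S).
case: x y => [[a|s] xv] [[b|t] yv] /=.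
- have aN : a != v by move: xv; rewrite /ins_vert_ok (inj_eq (@inl_inj _ _)).
  have bN : b != v by move: yv; rewrite /ins_vert_ok (inj_eq (@inl_inj _ _)).
  apply: (@cartan_collapse K L Q' cvert carr cwalk _ _ ins_relP
    (exist _ (inl b) yv) (exist _ (inl a) xv) (path_through v q0)).
  + move=> p; rewrite /cvert /= => pb pa.
    have [||| p' -> [p's p't p'p]] := @path_throughP q0 p; rewrite ?pb ?pa //.
    exists p' => //; split.
    * by apply: val_inj; rewrite p's pb.
    * by apply: val_inj; rewrite p't pa.
    * by apply: qpath_inj => //; rewrite qsrc_cpath /cvert p's.
  + move=> p' p's p't; apply: congP; rewrite bpath_wpath.
    have := cong_out q0P qmP aN (qpathP p'); rewrite -/(qtgt p') p't => /(_ erefl).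
    by rewrite p's /path_through qsrc_cpath p's.
  + move=> z zI zP; apply: mem_ideal_gen.
    exact: (Ins_3 (q := fun=> q0) zI zP).
- have aN : a != v by move: xv; rewrite /ins_vert_ok (inj_eq (@inl_inj _ _)).
  have [qmt qmm] := qmP t.
  apply: (@cartan_collapse K L Q' cvert carr cwalk _ _ ins_relP
    (exist _ (inr t) yv) (exist _ (inl a) xv)
    (fun p => ipath v (qm t) ** path_from v (qtgt (qm t)) p)).
  + move=> p; rewrite /cvert /= => pb pa.
    have pP : is_path (inr (qtgt (qm t))) (inl (qtgt p)) (qarr p)
        (path_from v (qtgt (qm t)) p).
      by apply: path_fromP; rewrite ?pa.
    have [p' -> [p's p't p'p]] := is_path_mul (is_path_ipath (qm t)) pP.
    exists p' => //; split.
    * by apply: val_inj; rewrite p's qmt.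
    * by apply: val_inj; rewrite p't pa.
    * by apply: qpath_inj => //; rewrite qsrc_cpath /cvert p's.
  + move=> p' p's p't; apply: congP; rewrite bpath_wpath.
    have := cong_out q0P qmP aN (qpathP p'); rewrite -/(qtgt p') p't => /(_ erefl).
    by rewrite p's.
  + move=> z zI zP.
    have -> : \sum_p z p *: (ipath v (qm t) ** path_from v (qtgt (qm t)) p)
        = ipath v (qm t) ** (\sum_p z p *: path_from v (qtgt (qm t)) p : KQ').
      by rewrite fdmul_sumr; apply: eq_bigr => p _; rewrite -fdscaleAr.
    by apply: Il; apply: mem_ideal_gen; exact: Ins_1b zI zP qmm.
- have bN : b != v by move: yv; rewrite /ins_vert_ok (inj_eq (@inl_inj _ _)).
  have [qs [mqs qss]] := path_from_min s.
  apply: (@cartan_collapse K L Q' cvert carr cwalk _ _ ins_relP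
    (exist _ (inl b) yv) (exist _ (inr s) xv)
    (fun p => path_into v p (qsrc qs) ** ipath v qs)).
  + move=> p; rewrite /cvert /= => pb pa.
    have pP : is_path (inl (qsrc p)) (inr (qsrc qs)) (qarr p) (path_into v p (qsrc qs)).
      by apply: path_intoP; rewrite ?pb.
    have [p' -> [p's p't p'p]] := is_path_mul pP (is_path_ipath qs).
    rewrite cats0 in p'p.
    exists p' => //; split.
    * by apply: val_inj; rewrite p's pb.
    * by apply: val_inj; rewrite p't qss.
    * by apply: qpath_inj => //; rewrite qsrc_cpath /cvert p's.
  + move=> p' p's p't; apply: congP; rewrite bpath_wpath.
    have := @cong_in qs b _ _ mqs (qpathP p'); rewrite -/(qtgt p') p't p's qss.
    move=> /(_ erefl erefl).
    by rewrite /path_into qsrc_cpath p's.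
  + move=> z zI zP; have -> : \sum_p z p *: (path_into v p (qsrc qs) ** ipath v qs)
        = (\sum_p z p *: path_into v p (qsrc qs) : KQ') ** ipath v qs.
      by rewrite fdmul_suml; apply: eq_bigr => p _; rewrite -fdscaleAl.
    by apply: Ir; apply: mem_ideal_gen; exact: Ins_1a zI zP mqs.
- have inner (p : qpath Q') : val (qsrc p) = inr t -> val (qtgt p) = inr s ->
      exists q : qpath H, [/\ qsrc q = t, qtgt q = s & bpath K p = ipath v q].
    move=> ps pt; have [_ [q [qs qt qE]]] := wpath_inner (qpathP p) pt ps.
    by exists q; rewrite bpath_wpath.
  rewrite /poset_cartan; case: (boolP (t <= s)%O) => [ts|/negP ts]; last first.
    apply: cartan_no_path => p ps pt; apply: ts.
    by have [||q [<- <- _]] := inner p; rewrite ?ps ?pt //; exact: qpath_le.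
  apply: etrans (cartan_diag R2 v).
  have [q [qs qt]] := hasse_path ts.
  apply: (@cartan_collapse K L Q' cvert carr cwalk _ _ ins_relP
    (exist _ (inr t) yv) (exist _ (inr s) xv) (fun=> ipath v q)).
  + move=> p; rewrite /cvert /= => pb pa.
    have [p' -> [p's p't p'p]] := is_path_ipath q.
    exists p' => //; split.
    * by apply: val_inj; rewrite p's qs.
    * by apply: val_inj; rewrite p't qt.
    * have p0 : qarr p = [::] by apply: acyclic (qpathP p) _; rewrite -/(qtgt p) pa pb.
      by apply: qpath_inj; rewrite ?p'p ?p0 // qsrc_cpath /cvert p's pb.
  + move=> p' p's p't; apply: congP.
    have [||q' [q's q't ->]] := inner p'; rewrite ?p's ?p't //.
    by apply: cong_ipath; rewrite ?q's ?q't.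
  + move=> z zI zP; rewrite (ideal_loop zI zP) big1 => [|p _]; first exact: mem0v.
    by rewrite ffunE scale0r.
Qed.

End AlgInsertion.

Lemma coxeter_insertion (K : fieldType) (L : triangular_algebra K) (v : vert L)
    (d : Order.disp_t) (S : finPOrderType d) :
  balanced (@poset_cox_mx _ S) ->
  coxeter_poly (insertion v S) =
    coxeter_poly (@corner K (tri_alg L) v) * poset_coxeter_poly S.
Proof.
move=> balS; rewrite /insertion; case: (eqVneq #|S| 0%N) => [S0|].
  by rewrite /poset_coxeter_poly (fin_det0 _ S0) mulr1.
rewrite -lt0n => /card_gt0P[s0 _].
pose u (a : {a | a != v}) : {poly int} :=
  'X * (@cartan K (tri_alg L) (val a) v)%:R + (@cartan K (tri_alg L) v (val a))%:R.
pose w (a : {a | a != v}) : {poly int} :=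
  'X * (@cartan K (tri_alg L) v (val a))%:R + (@cartan K (tri_alg L) (val a) v)%:R.
rewrite -(@det_inserted _ _ _ _ u w _ balS).
rewrite /coxeter_poly -(fin_det_bij _ (@to_inserted_bij _ v S)).
apply: eq_fin_det => [[a|s] [b|t]]; rewrite !(cartan_insertion s0) //=.
by rewrite !cartan_corner.
Qed.

Theorem corollary4p12 (d : Order.disp_t) (S : finPOrderType d) (hS : class_C S)
    (K : fieldType) :
  (refined_coxeter_poly S = 0 /\ cyclotomic_type (incidence_algebra S K)) /\
  (forall (L : triangular_algebra K) (v : vert L),
     coxeter_poly (insertion v S) =
       coxeter_poly (@corner K (tri_alg L) v) * poset_coxeter_poly S /\
     (cyclotomic_type (@corner K (tri_alg L) v) ->
        cyclotomic_type (insertion v S))).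
Proof.
have [balS cycS] := class_C_props hS; split.
  by split; [exact: balanced_refined | rewrite /cyclotomic_type coxeter_incidence].
move=> L v; have cox := coxeter_insertion v balS; split=> // cycL.
by rewrite /cyclotomic_type cox; exact: cyclotomic_productM.
Qed.
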